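(* Every simple purely infinite C*-algebra is of type III.
   Context: A simple C*-algebra $A$ is purely infinite if every nonzero hereditary C*-subalgebra of $A$ contains an infinite projection (a projection Murray–von Neumann equivalent to a proper subprojection of itself). For $S\subseteq B$ in a C*-algebra $B$, $\mathrm{Ann}_B(S)=\{a\in B: as+sa=0\ \forall s\in S\}$, and $\mathcal{P}_B=\{\mathrm{Ann}_B(\mathrm{Ann}_B(S)): S\subseteq B_+\}$ is the lattice of annihilators of $B$ (ordered by inclusion). Each $V\in\mathcal{P}_A$ is a C*-subalgebra; $V$ is modular if $\mathcal{P}_V$ (annihilators computed inside $V$) is a modular lattice. $\mathcal{P}_A$ is purely nonmodular if there is no nonzero modular annihilator in $\mathcal{P}_A$. $A$ is of type III if $\mathcal{P}_A$ is purely nonmodular. *)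

(* Defs.v *)
From mathcomp Require Import all_boot all_algebra.
From mathcomp Require Import complex.
From mathcomp Require Import reals.
Set Implicit Arguments.
Unset Strict Implicit.
Unset Printing Implicit Defensive.
Import GRing.Theory Num.Theory.
Local Open Scope ring_scope.

Record cstar_alg (R : realType) (A : lmodType R[i]) := CstarAlg {
  mul : A -> A -> A;
  star : A -> A;
  nrm : A -> R;
  mulA : forall a b c, mul a (mul b c) = mul (mul a b) c;
  mulDl : forall a b c, mul (a + b) c = mul a c + mul b c;
  mulDr : forall a b c, mul a (b + c) = mul a b + mul a c;
  mulZl : forall (k : R[i]) a b, mul (k *: a) b = k *: mul a b;
  mulZr : forall (k : R[i]) a b, mul a (k *: b) = k *: mul a b;
  starK : forall a, star (star a) = a;
  starD : forall a b, star (a + b) = star a + star b;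
  starZ : forall (k : R[i]) a, star (k *: a) = conjc k *: star a;
  starM : forall a b, star (mul a b) = mul (star b) (star a);
  nrm_ge0 : forall a, 0 <= nrm a;
  nrm_eq0 : forall a, nrm a = 0 -> a = 0;
  nrm_triangle : forall a b, nrm (a + b) <= nrm a + nrm b;
  nrmZ : forall (k : R[i]) a, real_complex R (nrm (k *: a)) = `|k| * real_complex R (nrm a);
  nrm_submul : forall a b, nrm (mul a b) <= nrm a * nrm b;
  nrm_cstar : forall a, nrm (mul (star a) a) = nrm a ^+ 2;
  complete : forall u : nat -> A,
    (forall e : R, 0 < e -> exists N, forall m n, (N <= m)%N -> (N <= n)%N ->
        nrm (u m - u n) < e) ->
    exists l : A, forall e : R, 0 < e -> exists N, forall n, (N <= n)%N ->
        nrm (u n - l) < e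
}.

Section CstarDefs.
Variables (R : realType) (A : lmodType R[i]) (X : cstar_alg A).

Local Notation "a ** b" := (mul X a b) (at level 40, left associativity).
Local Notation "a ^*s" := (star X a) (at level 2).

Definition norm_closed (S : A -> Prop) : Prop :=
  forall (u : nat -> A) (l : A), (forall n, S (u n)) ->
    (forall e : R, 0 < e -> exists N, forall n, (N <= n)%N -> nrm X (u n - l) < e) ->
    S l.

Definition cstar_subalg (B : A -> Prop) : Prop :=
  [/\ B 0 /\ (forall a b, B a -> B b -> B (a + b)),
      forall (k : R[i]) a, B a -> B (k *: a),
      forall a b, B a -> B b -> B (a ** b),
      forall a, B a -> B (a ^*s) &
      norm_closed B].

(* quasi-invertibility (invertibility of 1 - a in the unitization) *)
Definition quasi_invertible (a : A) : Prop :=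
  exists b : A, a + b - a ** b = 0 /\ a + b - b ** a = 0.

(* positive elements: self-adjoint with spectrum in [0, +oo).  The spectrum is
   taken in the unitization; for lambda <> 0, lambda is outside the spectrum of a
   iff lambda^-1 a is quasi-invertible, and 0 is always in [0,+oo). *)
Definition positive (a : A) : Prop :=
  a ^*s = a /\
  forall lambda : R[i], ~ (0 <= lambda) -> quasi_invertible (lambda^-1 *: a).

Definition le_cstar (a b : A) : Prop := positive (b - a).

Definition hereditary (B : A -> Prop) : Prop :=
  cstar_subalg B /\
  forall a b, B b -> positive a -> le_cstar a b -> B a.

Definition nonzero_set (B : A -> Prop) : Prop := exists x, B x /\ x <> 0.

Definition projection (p : A) : Prop := p ** p = p /\ p ^*s = p.

Definition mvN_equiv (p q : A) : Prop :=
  exists v : A, v ^*s ** v = p /\ v ** v ^*s = q.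

Definition subprojection (q p : A) : Prop := projection q /\ p ** q = q.

Definition infinite_projection (p : A) : Prop :=
  projection p /\ exists q, subprojection q p /\ q <> p /\ mvN_equiv p q.

Definition closed_ideal (I : A -> Prop) : Prop :=
  [/\ I 0 /\ (forall a b, I a -> I b -> I (a + b)),
      forall (k : R[i]) a, I a -> I (k *: a),
      forall a x, I x -> I (a ** x) /\ I (x ** a) &
      norm_closed I].

Definition simple_cstar : Prop :=
  (exists x : A, x <> 0) /\
  forall I, closed_ideal I -> (forall x, I x -> x = 0) \/ (forall x, I x).

Definition purely_infinite : Prop :=
  forall B, hereditary B -> nonzero_set B -> exists p, B p /\ infinite_projection p.

Definition Ann (B S : A -> Prop) : A -> Prop :=
  fun a => B a /\ forall s, S s -> a ** s + s ** a = 0.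

Definition annihilators (B : A -> Prop) : (A -> Prop) -> Prop :=
  fun V => exists S : A -> Prop, (forall s, S s -> B s /\ positive s) /\
                                 V = Ann B (Ann B S).

Definition subset (U V : A -> Prop) : Prop := forall x, U x -> V x.

Definition is_lub (P : (A -> Prop) -> Prop) (U V J : A -> Prop) : Prop :=
  [/\ P J, subset U J, subset V J &
      forall W, P W -> subset U W -> subset V W -> subset J W].

Definition is_glb (P : (A -> Prop) -> Prop) (U V M : A -> Prop) : Prop :=
  [/\ P M, subset M U, subset M V &
      forall W, P W -> subset W U -> subset W V -> subset W M].

Definition modular_lattice (P : (A -> Prop) -> Prop) : Prop :=
  (forall U V, P U -> P V -> (exists J, is_lub P U V J) /\ (exists M, is_glb P U V M)) /\
  forall x y z m j1 j2 m2, P x -> P y -> P z -> subset x z ->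
    is_glb P y z m -> is_lub P x m j1 ->
    is_lub P x y j2 -> is_glb P j2 z m2 -> j1 = m2.

Definition modular_annihilator (V : A -> Prop) : Prop :=
  modular_lattice (annihilators V).

Definition purely_nonmodular : Prop :=
  forall V, annihilators (fun _ => True) V -> nonzero_set V -> ~ modular_annihilator V.

Definition type_III : Prop := purely_nonmodular.

End CstarDefs.

(* Main.v *)
From HB Require Import structures.
From mathcomp Require Import all_boot all_order all_algebra.
From mathcomp Require Import complex.
From mathcomp Require Import boolp classical_sets reals.
From mathcomp Require Import ring lra.
Require Import Defs.
(** Only spectral positivity of the order is available, so positivity is first translated into norms of multipliers (bounded adjointable maps [A -> A]): a spectrally positive [a] is [m (1 - Q)] with [Q] a selfadjoint contraction, because a selfadjoint contraction [h] with [1 - h^2] invertible is a strict contraction. Such elements form a cone with enough order theory to show that a double annihilator [V] is a hereditary C*-subalgebra. Pure infiniteness then yields a projection [p] in [V] and [v] with [v^* v = p] and [v v^* = q < p], and [p A p] is contained in [V].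

The vectors [w_n = v^n (p - q)] are orthogonal and infinite in number. As in the classical non-modularity proof for closed subspaces of a Hilbert space, let [y] be generated by the [w_(2n)], [z] by the graph vectors [u_n = w_(2n) + 4^-n w_(2n+1)], and [x] by the differences [u_n - 2 u_(n+1)]. Then [x] is strictly smaller than [z], [y] meets [z] trivially, and [x] and [y] have the same annihilator as [y] and [z] together: a pentagon in the lattice of annihilators of [V]. *)
Set Implicit Arguments.
Unset Strict Implicit.
Unset Printing Implicit Defensive.
Import Order.TTheory GRing.Theory Num.Theory ComplexField.Normc.
Local Open Scope ring_scope.
Local Open Scope complex_scope.

(** * Multipliers of a C*-algebra *)

Section RealPowers.
Variable R : realType.

(** Induction gives n (1 - c) c^n <= 1 - c^n, so c^n decays at least like 1/n and an Archimedean
    choice of n suffices. *)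
Lemma geometric_small (c D e : R) : 0 <= c < 1 -> 0 < e ->
  exists N, forall n, (N <= n)%N -> c ^+ n * D < e.
Proof.
move=> /andP[c0 c1] e0.
have key n : n%:R * (1 - c) * c ^+ n <= 1 - c ^+ n.
  elim: n => [|n IH]; first by rewrite expr0 !mul0r subrr.
  have x0 : 0 <= c ^+ n by rewrite exprn_ge0.
  have x1 : c ^+ n <= 1 by rewrite exprn_ile1 // ltW.
  rewrite exprS -natr1; move: (c ^+ n) IH x0 x1 => x IH x0 x1.
  have cx : c * x <= 1 by rewrite mulr_ile1 // ltW.
  have c1' : 0 <= 1 - c by rewrite subr_ge0 ltW.
  have cx' : 0 <= 1 - c * x by rewrite subr_ge0.
  have := mulr_ge0 c1' cx'; have := ler_wpM2l c0 IH; nra.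
have [D0|D0] := lerP D 0.
  exists 0%N => n _; apply: le_lt_trans e0.
  by rewrite mulr_ge0_le0 // exprn_ge0.
have d0 : 0 < (1 - c) * e by rewrite mulr_gt0 // subr_gt0.
pose N := Num.bound (D / ((1 - c) * e)); exists N => n Nn.
have: D / ((1 - c) * e) < n%:R.
  apply: lt_le_trans (archi_boundP _) _; last by rewrite ler_nat.
  by rewrite divr_ge0 // ltW.
rewrite ltr_pdivrMr // => lt1.
have := key n; have: 0 <= c ^+ n by rewrite exprn_ge0.
move: (c ^+ n) (n%:R) lt1 => x m lt1 x0 H.
have [->|xn0] := eqVneq x 0; first by rewrite mul0r.
have xp : 0 < x by rewrite lt_neqAle eq_sym xn0.
have := ltr_pM2l xp D (m * ((1 - c) * e)); rewrite lt1 => h1.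
apply: lt_le_trans h1 _.
have := ler_wpM2r (ltW e0) H; nra.
Qed.

End RealPowers.

Section Norm.
Variables (R : realType) (A : lmodType R[i]) (X : cstar_alg A).
Local Notation "a ** b" := (mul X a b) (at level 40, left associativity).
Local Notation st := (star X).
Local Notation nm := (nrm X).

Lemma cmul0l a : 0 ** a = 0.
Proof. by rewrite -[in LHS](scale0r 0) mulZl scale0r. Qed.
Lemma cmul0r a : a ** 0 = 0.
Proof. by rewrite -[in LHS](scale0r 0) mulZr scale0r. Qed.
Lemma cmulNl a b : (- a) ** b = - (a ** b).
Proof. by rewrite -scaleN1r mulZl scaleN1r. Qed.
Lemma cmulNr a b : a ** (- b) = - (a ** b).
Proof. by rewrite -scaleN1r mulZr scaleN1r. Qed.
Lemma cmulBl a b c : (a - b) ** c = a ** c - b ** c.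
Proof. by rewrite mulDl cmulNl. Qed.
Lemma cmulBr a b c : a ** (b - c) = a ** b - a ** c.
Proof. by rewrite mulDr cmulNr. Qed.
Lemma star0 : st 0 = 0.
Proof. by rewrite -[in LHS](scale0r 0) starZ conjc0 scale0r. Qed.
Lemma starN a : st (- a) = - st a.
Proof. by rewrite -scaleN1r starZ rmorphN1 scaleN1r. Qed.
Lemma starB a b : st (a - b) = st a - st b.
Proof. by rewrite starD starN. Qed.

Lemma nrm0 : nm 0 = 0.
Proof.
apply: (@complexI R); by rewrite -[in LHS](scale0r 0) nrmZ normr0 mul0r.
Qed.
Lemma nrmZc k a : nm (k *: a) = normc k * nm a.
Proof. by apply: (@complexI R); rewrite nrmZ rmorphM. Qed.
Lemma normc_real (r : R) : normc r%:C = `|r|.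
Proof. by rewrite /= expr0n addr0 sqrtr_sqr. Qed.
Lemma normc_i : normc 'i = 1 :> R.
Proof. by rewrite /= expr0n add0r expr1n sqrtr1. Qed.
Lemma nrmN a : nm (- a) = nm a.
Proof. by rewrite -scaleN1r nrmZc normcN normc1 mul1r. Qed.
Lemma nrmB a b : nm (a - b) <= nm a + nm b.
Proof. by rewrite (le_trans (nrm_triangle X _ _)) // nrmN. Qed.
Lemma star_mul_eq0 a : st a ** a = 0 -> a = 0.
Proof.
move=> H; apply: (@nrm_eq0 _ _ X); have := nrm_cstar X a; rewrite H nrm0.
by move/esym/eqP; rewrite sqrf_eq0 => /eqP.
Qed.
Lemma mul_star_eq0 a : a ** st a = 0 -> a = 0.
Proof.
rewrite -{1}(starK X a) => /star_mul_eq0 H.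
by rewrite -(starK X a) H star0.
Qed.
(** Taking x = y - z reduces to [star_mul_eq0]. With x^* y as an [A]-valued inner product, this says
    that inner products separate points. *)
Lemma mul_left_faithful y z : (forall x, st x ** y = st x ** z) -> y = z.
Proof.
move=> H; apply/eqP; rewrite -subr_eq0; apply/eqP/star_mul_eq0.
by rewrite cmulBr H subrr.
Qed.
Lemma nrm_star a : nm (st a) = nm a.
Proof.
suff H b : nm b <= nm (st b).
  by apply/eqP; rewrite eq_le H andbT -{2}(starK X a) H.
have := nrm_submul X (st b) b; rewrite nrm_cstar expr2.
have [b0|b0] := eqVneq (nm b) 0; first by rewrite b0 nrm_ge0.
by rewrite ler_pM2r // lt_neqAle eq_sym b0 nrm_ge0.
Qed.
Lemma nrm_small_eq0 a : (forall e, 0 < e -> nm a < e) -> a = 0.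
Proof.
move=> H; apply: (@nrm_eq0 _ _ X); apply/eqP; rewrite eq_le nrm_ge0 andbT.
by apply/ler_addgt0Pl => e /H /ltW; rewrite addr0.
Qed.

(** * Bounded adjointable maps for the inner product x^* y *)

Definition adjoint_pair (f g : A -> A) := forall x y, st (f x) ** y = st x ** g y.
Definition bounded (c : R) (f : A -> A) := forall x, nm (f x) <= c * nm x.

Lemma adjoint_pair_sym f g : adjoint_pair f g -> adjoint_pair g f.
Proof.
by move=> H x y; rewrite -[LHS](starK X) starM starK -H starM starK.
Qed.

Lemma bounded_weaken c d f : c <= d -> bounded c f -> bounded d f.
Proof.
move=> cd H x; apply: le_trans (H x) _; apply: ler_wpM2r => //.
exact: nrm_ge0.
Qed.

Lemma bounded_max c f : bounded c f -> bounded (Num.max c 0) f.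
Proof. by apply: bounded_weaken; rewrite le_max lexx. Qed.

(** The C*-identity for maps: |f x|^2 = |x^* g (f x)| <= |x| |g (f x)|. *)
Lemma bounded_sqrt c f g : adjoint_pair f g -> 0 <= c ->
  bounded (c ^+ 2) (g \o f) -> bounded c f.
Proof.
move=> H c0 b x.
rewrite -(@ler_pXn2r _ 2) ?nnegrE ?mulr_ge0 ?nrm_ge0 //.
rewrite -nrm_cstar H; apply: le_trans (nrm_submul X _ _) _.
rewrite nrm_star exprMn mulrC expr2 mulrA.
by apply: ler_wpM2r; rewrite ?nrm_ge0 //; apply: b.
Qed.

Lemma bounded_adjoint c f g : 0 <= c -> adjoint_pair f g -> bounded c f -> bounded c g.
Proof.
move=> c0 H b x.
have [->|g0] := eqVneq (nm (g x)) 0; first by rewrite mulr_ge0 ?nrm_ge0.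
have gp : 0 < nm (g x) by rewrite lt_neqAle eq_sym g0 nrm_ge0.
rewrite -(ler_pM2r gp) -expr2 -nrm_cstar.
rewrite (adjoint_pair_sym H); apply: le_trans (nrm_submul X _ _) _.
by rewrite nrm_star mulrC mulrAC; apply: ler_wpM2r; rewrite ?nrm_ge0.
Qed.

(* A multiplier is stored with its adjoint; bounding the first map also bounds the second. *)
Record op := Op { opf : A -> A; opg : A -> A;
  op_adj : adjoint_pair opf opg; op_bnd : exists c, bounded c opf }.

Lemma op_eq (u v : op) : opf u =1 opf v -> u = v.
Proof.
case: u v => [f g H b] [f' g' H' b'] /= /funext E; subst f'.
have E : g = g'.
  by apply: funext => y; apply: mul_left_faithful => x; rewrite -H -H'.
subst g'; congr Op; exact: Prop_irrelevance.
Qed.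

(** Linearity need not be stored in [op]: moving the map to the other side of the inner product
    forces it. *)
Lemma opfD (u : op) x y : opf u (x + y) = opf u x + opf u y.
Proof.
apply: mul_left_faithful => z; have H := adjoint_pair_sym (op_adj u).
by rewrite mulDr -!H mulDr.
Qed.
Lemma opfZ (u : op) k x : opf u (k *: x) = k *: opf u x.
Proof.
apply: mul_left_faithful => z; have H := adjoint_pair_sym (op_adj u).
by rewrite mulZr -!H mulZr.
Qed.
Lemma opfN (u : op) x : opf u (- x) = - opf u x.
Proof. by rewrite -scaleN1r opfZ scaleN1r. Qed.

Definition adj (u : op) : op.
Proof.
exists (opg u) (opf u); first exact/adjoint_pair_sym/op_adj.
have [c /bounded_max b] := op_bnd u; exists (Num.max c 0).
by apply: bounded_adjoint b; [rewrite le_max lexx orbT|exact: op_adj].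
Defined.

Definition op_zero : op.
Proof.
exists (fun=> 0) (fun=> 0); first by move=> x y; rewrite star0 cmul0l cmul0r.
by exists 0 => x; rewrite nrm0 mul0r.
Defined.
Definition op_one : op.
Proof.
by exists id id => //; exists 1 => x; rewrite mul1r.
Defined.
Definition op_add (u v : op) : op.
Proof.
exists (fun x => opf u x + opf v x) (fun x => opg u x + opg v x).
  by move=> x y; rewrite starD mulDl mulDr !op_adj.
have [c b] := op_bnd u; have [d b'] := op_bnd v; exists (c + d) => x.
by rewrite mulrDl (le_trans (nrm_triangle X _ _)) // lerD.
Defined.
Definition op_scale (k : R[i]) (u : op) : op.
Proof.
exists (fun x => k *: opf u x) (fun x => conjc k *: opg u x).
  by move=> x y; rewrite starZ mulZl mulZr op_adj.
have [c b] := op_bnd u; exists (normc k * c) => x.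
rewrite nrmZc -mulrA; apply: ler_wpM2l; last exact: b.
by case: (k) => p q; exact: sqrtr_ge0.
Defined.
Definition op_mul (u v : op) : op.
Proof.
exists (opf u \o opf v) (opg v \o opg u); first by move=> x y /=; rewrite !op_adj.
have [c /bounded_max b] := op_bnd u; have [d b'] := op_bnd v.
exists (Num.max c 0 * d) => x; rewrite /= -mulrA; apply: le_trans (b _) _.
by apply: ler_wpM2l; rewrite ?le_max ?lexx ?orbT.
Defined.

HB.instance Definition _ := gen_eqMixin op.
HB.instance Definition _ := gen_choiceMixin op.

Lemma op_addA : associative op_add.
Proof. by move=> u v w; apply: op_eq => x; rewrite /= addrA. Qed.
Lemma op_addC : commutative op_add.
Proof. by move=> u v; apply: op_eq => x; rewrite /= addrC. Qed.
Lemma op_add0 : left_id op_zero op_add.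
Proof. by move=> u; apply: op_eq => x; rewrite /= add0r. Qed.
Lemma op_addN : left_inverse op_zero (op_scale (-1)) op_add.
Proof. by move=> u; apply: op_eq => x; rewrite /= scaleN1r addNr. Qed.
HB.instance Definition _ := GRing.isZmodule.Build op op_addA op_addC op_add0 op_addN.

Lemma op_mulA : associative op_mul.
Proof. by move=> u v w; apply: op_eq. Qed.
Lemma op_mul1 : left_id op_one op_mul.
Proof. by move=> u; apply: op_eq. Qed.
Lemma op_mulr1 : right_id op_one op_mul.
Proof. by move=> u; apply: op_eq. Qed.
Lemma op_mulDl : left_distributive op_mul +%R.
Proof. by move=> u v w; apply: op_eq. Qed.
Lemma op_mulDr : right_distributive op_mul +%R.
Proof. by move=> u v w; apply: op_eq => x; rewrite /= opfD. Qed.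
HB.instance Definition _ :=
  GRing.Zmodule_isPzRing.Build op op_mulA op_mul1 op_mulr1 op_mulDl op_mulDr.

Lemma op_scaleA a b u : op_scale a (op_scale b u) = op_scale (a * b) u.
Proof. by apply: op_eq => x; rewrite /= scalerA. Qed.
Lemma op_scale1 : left_id 1 op_scale.
Proof. by move=> u; apply: op_eq => x; rewrite /= scale1r. Qed.
Lemma op_scaleDr : right_distributive op_scale +%R.
Proof. by move=> k u v; apply: op_eq => x; rewrite /= scalerDr. Qed.
Lemma op_scaleDl u : {morph op_scale^~ u : a b / a + b}.
Proof. by move=> a b; apply: op_eq => x; rewrite /= scalerDl. Qed.
HB.instance Definition _ := GRing.Zmodule_isLmodule.Build R[i] op
  op_scaleA op_scale1 op_scaleDr op_scaleDl.

Lemma opScaleAl k (u v : op) : k *: (u * v) = (k *: u) * v.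
Proof. by apply: op_eq. Qed.
Lemma opScaleAr k (u v : op) : k *: (u * v) = u * (k *: v).
Proof. by apply: op_eq => x; rewrite /= opfZ. Qed.

Lemma opfE_add (u v : op) x : opf (u + v) x = opf u x + opf v x. Proof. by []. Qed.
Lemma opfE_opp (u : op) x : opf (- u) x = - opf u x.
Proof. by rewrite -scaleN1r. Qed.
Lemma opfE_scale k (u : op) x : opf (k *: u) x = k *: opf u x. Proof. by []. Qed.
Lemma opfE_mul (u v : op) x : opf (u * v) x = opf u (opf v x). Proof. by []. Qed.
Lemma opfE_one x : opf (1 : op) x = x. Proof. by []. Qed.
Lemma opfE_zero x : opf (0 : op) x = 0. Proof. by []. Qed.
Definition opE := (opfE_add, opfE_opp, opfE_scale, opfE_mul, opfE_one, opfE_zero).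

Lemma adjK u : adj (adj u) = u. Proof. exact: op_eq. Qed.
Lemma adjD u v : adj (u + v) = adj u + adj v. Proof. exact: op_eq. Qed.
Lemma adjM u v : adj (u * v) = adj v * adj u. Proof. exact: op_eq. Qed.
Lemma adjZ k u : adj (k *: u) = conjc k *: adj u. Proof. exact: op_eq. Qed.
Lemma adj1 : adj 1 = 1. Proof. exact: op_eq. Qed.
Lemma adjN u : adj (- u) = - adj u.
Proof. by rewrite -scaleN1r adjZ rmorphN1 scaleN1r. Qed.
Lemma adjB u v : adj (u - v) = adj u - adj v.
Proof. by rewrite adjD adjN. Qed.
Lemma adjX u n : adj (u ^+ n) = adj u ^+ n.
Proof.
by elim: n => [|n IH]; rewrite ?expr0 ?adj1 // exprS adjM IH -exprSr.
Qed.

Definition bnd (c : R) (u : op) := bounded c (opf u).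

Lemma bnd_weaken c d u : c <= d -> bnd c u -> bnd d u.
Proof. exact: bounded_weaken. Qed.
Lemma bnd_exists u : exists2 c, 0 < c & bnd c u.
Proof.
have [c b] := op_bnd u; exists (Num.max c 1); first by rewrite lt_max ltr01 orbT.
by apply: bounded_weaken b; rewrite le_max lexx.
Qed.
Lemma bndD c d u v : bnd c u -> bnd d v -> bnd (c + d) (u + v).
Proof.
by move=> b b' x; rewrite mulrDl (le_trans (nrm_triangle X _ _)) // lerD.
Qed.
Lemma bndM c d u v : 0 <= c -> bnd c u -> bnd d v -> bnd (c * d) (u * v).
Proof.
move=> c0 b b' x; rewrite -mulrA; apply: le_trans (b _) _.
by apply: ler_wpM2l.
Qed.
Lemma bndZ k c u : bnd c u -> bnd (normc k * c) (k *: u).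
Proof.
move=> b x; rewrite opE nrmZc -mulrA; apply: ler_wpM2l; last exact: b.
by case: (k) => p q; exact: sqrtr_ge0.
Qed.
Lemma bndN c u : bnd c u -> bnd c (- u).
Proof. by move=> b x; rewrite opE nrmN. Qed.
Lemma bndB c d u v : bnd c u -> bnd d v -> bnd (c + d) (u - v).
Proof. by move=> b /bndN; exact: bndD. Qed.
Lemma bnd1 : bnd 1 1.
Proof. by move=> x; rewrite mul1r. Qed.
Lemma bndX c u n : 0 <= c -> bnd c u -> bnd (c ^+ n) (u ^+ n).
Proof.
move=> c0 b; elim: n => [|n IH]; first exact: bnd1.
by rewrite !exprS; apply: bndM.
Qed.
Lemma bnd_sqrt c u : 0 <= c -> bnd (c ^+ 2) (adj u * u) -> bnd c u.
Proof. by apply: bounded_sqrt; exact: op_adj. Qed.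
Lemma bnd_adj c u : 0 <= c -> bnd c u -> bnd c (adj u).
Proof. by move=> c0; apply: bounded_adjoint => //; exact: op_adj. Qed.
Lemma bnd_neg_eq0 c u : c <= 0 -> bnd c u -> u = 0.
Proof.
move=> c0 b; apply: op_eq => x; apply: (@nrm_eq0 _ _ X).
apply/eqP; rewrite eq_le nrm_ge0 andbT (le_trans (b x)) //.
by rewrite mulr_le0_ge0 ?nrm_ge0.
Qed.

(** The left regular representation. It embeds [A] in a unital algebra, which replaces the
    unitization in spectral arguments. *)
Definition Lm (a : A) : op.
Proof.
exists (mul X a) (mul X (st a)).
  by move=> x y; rewrite starM mulA.
by exists (nm a) => x; exact: nrm_submul.
Defined.

Lemma LmM a b : Lm (a ** b) = Lm a * Lm b.
Proof. by apply: op_eq => x; rewrite /= mulA. Qed.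
Lemma LmD a b : Lm (a + b) = Lm a + Lm b.
Proof. by apply: op_eq => x; rewrite /= mulDl. Qed.
Lemma LmZ k a : Lm (k *: a) = k *: Lm a.
Proof. by apply: op_eq => x; rewrite /= mulZl. Qed.
Lemma LmN a : Lm (- a) = - Lm a.
Proof. by rewrite -scaleN1r LmZ scaleN1r. Qed.
Lemma LmB a b : Lm (a - b) = Lm a - Lm b.
Proof. by rewrite LmD LmN. Qed.
Lemma Lm0 : Lm 0 = 0.
Proof. by apply: op_eq => x; rewrite /= cmul0l. Qed.
Lemma Lm_star a : adj (Lm a) = Lm (st a).
Proof. exact: op_eq. Qed.
Lemma Lm_inj a b : Lm a = Lm b -> a = b.
Proof.
move=> /(congr1 opf) /= E; rewrite -[a](starK X) -[b](starK X); congr (st _).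
by apply: mul_left_faithful => x; rewrite -!starM E.
Qed.
Lemma bnd_Lm a : bnd (nm a) (Lm a).
Proof. by move=> x; exact: nrm_submul. Qed.

End Norm.

(** * Invertibility and the spectral radius *)

Section Spectral.
Variables (R : realType) (A : lmodType R[i]) (X : cstar_alg A).
Local Notation nm := (nrm X).
Local Notation op := (op X).
Implicit Types (u v w h g G : op) (c r : R).

Definition sc (r : R) : op := locked (r%:C *: (1 : op)).

Lemma scE r : sc r = r%:C *: (1 : op). Proof. by rewrite /sc -lock. Qed.
Lemma scM_l r u : sc r * u = r%:C *: u.
Proof. by rewrite scE -opScaleAl mul1r. Qed.
Lemma scM_r r u : u * sc r = r%:C *: u.
Proof. by rewrite scE -opScaleAr mulr1. Qed.
Lemma sc1 : sc 1 = 1. Proof. by rewrite scE scale1r. Qed.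
Lemma scD r s : sc (r + s) = sc r + sc s.
Proof. by rewrite !scE rmorphD scalerDl. Qed.
Lemma scN r : sc (- r) = - sc r.
Proof. by rewrite !scE rmorphN scaleNr. Qed.
Lemma scM r s : sc (r * s) = sc r * sc s.
Proof. by rewrite scM_l !scE scalerA rmorphM. Qed.
Lemma adj_sc r : adj (sc r) = sc r.
Proof. by rewrite scE adjZ adj1 conjc_real. Qed.
Lemma adjZr r u : adj (r%:C *: u) = r%:C *: adj u.
Proof. by rewrite adjZ conjc_real. Qed.

Lemma bndZr r c u : 0 <= r -> bnd c u -> bnd (r * c) (r%:C *: u).
Proof. by move=> r0 /(bndZ r%:C); rewrite normc_real ger0_norm. Qed.
Lemma bnd_sc r : 0 <= r -> bnd r (sc r).
Proof. by move=> r0; rewrite -[X in bnd X](mulr1 r) scE; apply/bndZr/bnd1. Qed.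

Definition inv u := exists v, u * v = 1 /\ v * u = 1.

Lemma invM u v : inv u -> inv v -> inv (u * v).
Proof.
move=> [u' [a b]] [v' [c d]]; exists (v' * u'); split.
  by rewrite mulrA -[u * v * v']mulrA c mulr1.
by rewrite mulrA -[v' * u' * u]mulrA b mulr1.
Qed.
Lemma inv_sc r : r != 0 -> inv (sc r).
Proof.
by move=> r0; exists (sc r^-1); rewrite -!scM divff // mulVf // sc1.
Qed.
Lemma inv_scale r u : r != 0 -> inv u -> inv (r%:C *: u).
Proof. by move=> r0 iu; rewrite -scM_l; apply: invM => //; apply: inv_sc. Qed.

(** Jacobson's trick: if w inverts 1 + u v, then 1 - v w u inverts 1 + v u. Hence u v and v u have
    the same spectrum away from 0. *)
Lemma inv_swap u v : inv (1 + u * v) -> inv (1 + v * u).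
Proof.
move=> [w [a b]]; exists (1 - v * w * u).
have a' : w + u * v * w = 1 by rewrite -a mulrDl mul1r.
have b' : w + w * (u * v) = 1 by rewrite -b mulrDr mulr1.
have comm1 : v * w * u + v * u * (v * w * u) = v * u.
  have -> : v * u * (v * w * u) = v * (u * v * w) * u by rewrite !mulrA.
  by rewrite -mulrDl -mulrDr a' mulr1.
have comm2 : v * w * u + v * w * u * (v * u) = v * u.
  have -> : v * w * u * (v * u) = v * (w * (u * v)) * u by rewrite !mulrA.
  by rewrite -mulrDl -mulrDr b' mulr1.
split.
  by rewrite mulrBr mulr1 mulrDl mul1r comm1 addrK.
by rewrite mulrBl mul1r mulrDr mulr1 comm2 addrK.
Qed.

Lemma inv_swap_sc r u v : r != 0 -> inv (sc r + u * v) -> inv (sc r + v * u).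
Proof.
move=> r0; have E a b : sc r + a * b = r%:C *: (1 + (r^-1%:C *: a) * b).
  by rewrite scE scalerDr -opScaleAl scalerA -rmorphM divff // scale1r.
move=> H; have {}H : inv (1 + (r^-1%:C *: u) * v).
  have ri : r^-1 != 0 by rewrite invr_eq0.
  have := inv_scale ri H; rewrite E scalerA -rmorphM mulVf //.
  by rewrite scale1r.
have := inv_scale r0 (inv_swap H).
by rewrite -opScaleAr opScaleAl -E.
Qed.

(** * Neumann series *)

Section Neumann.
Variables (c : R) (y : op).
Hypothesis c01 : 0 <= c < 1.
Hypothesis yc : bnd c y.

Fixpoint neumann (x : A) (n : nat) : A :=
  if n is m.+1 then x + opf y (neumann x m) else 0.

(** The partial sums of x + y x + y^2 x + ... are Cauchy with geometric rate, and their limit solves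
    the equation. *)
Lemma neumann_surj x : exists l, l - opf y l = x.
Proof.
have /andP[c0 c1] := c01; have d0 : 0 < 1 - c by rewrite subr_gt0.
pose D := nm x / (1 - c).
have nb n : nm (neumann x n) <= D.
  elim: n => [|n IH] /=; first by rewrite nrm0 divr_ge0 ?nrm_ge0 ?ltW.
  have -> : D = nm x + c * D.
    rewrite {2}/D /D; field; lra.
  apply: le_trans (nrm_triangle X _ _) _; rewrite lerD2l.
  by apply: le_trans (yc _) _; apply: ler_wpM2l.
have diff k n : nm (neumann x (n + k) - neumann x n) <= c ^+ n * D.
  elim: n => [|n IH]; first by rewrite add0n subr0 mul1r.
  rewrite addSn /= opprD addrACA subrr add0r -opfN -opfD.
  by rewrite exprS -mulrA; apply: le_trans (yc _) _; apply: ler_wpM2l.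
have [|l hl] := @complete _ _ X (neumann x).
  move=> e e0; have [N HN] := geometric_small D c01 e0; exists N.
  move=> m n Nm Nn; wlog mn : m n Nm Nn / (n <= m)%N.
    move=> H; have [|/ltnW] := leqP n m; first exact: H.
    by move=> mn; rewrite -nrmN opprB; apply: H.
  by rewrite -(subnKC mn); apply: le_lt_trans (diff _ _) (HN _ Nn).
exists l; apply/eqP; rewrite -subr_eq0; apply/eqP/nrm_small_eq0 => e e0.
have [|N HN] := hl (e / 2); first by rewrite divr_gt0.
have h1 := HN N.+1 (leqW (leqnn N)); have h2 := HN N (leqnn N).
have E : l - opf y l - x =
    opf y (neumann x N - l) - (neumann x N.+1 - l).
  rewrite opfD opfN /=.
  rewrite !opprD !opprK [- x + _]addrC !addrA.
  rewrite [opf y (neumann x N) - opf y l]addrC.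
  by rewrite addrK addrC addrA.
rewrite E; apply: le_lt_trans (nrmB X _ _) _.
rewrite (splitr e); apply: ltr_leD; last exact: ltW.
apply: le_lt_trans (yc _) _; apply: le_lt_trans h2.
by rewrite ler_piMl ?nrm_ge0 // ltW.
Qed.

Lemma neumann_inj z : z = opf y z -> z = 0.
Proof.
have /andP[c0 c1] := c01; move=> E; apply: (@nrm_eq0 _ _ X).
have := yc z; rewrite -E; have := nrm_ge0 X z; nra.
Qed.
End Neumann.

(** The inverse must itself be a multiplier: the solution maps f for y and g for its adjoint are
    adjoint to each other, and f is bounded by 1 / (1 - c). *)
Lemma inv_1sub c y : 0 <= c < 1 -> bnd c y -> inv (1 - y).
Proof.
move=> c01 yc; have /andP[c0 c1] := c01; have yc' := bnd_adj c0 yc.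
have [f Hf] := choice (neumann_surj c01 yc).
have [g Hg] := choice (neumann_surj c01 yc').
have fg : adjoint_pair X f g.
  move=> a b; rewrite -{1}(Hg b) -{2}(Hf a).
  by rewrite cmulBr starB cmulBl (op_adj y).
have bf : exists c, bounded X c f.
  exists (1 - c)^-1 => a; rewrite ler_pdivlMl ?subr_gt0 //.
  have := nrm_triangle X (f a - opf y (f a)) (opf y (f a)).
  rewrite subrK Hf; have := yc (f a); lra.
exists (Op fg bf).
have inj a b : a - opf y a = b - opf y b -> a = b.
  move=> E; apply/eqP; rewrite -subr_eq0; apply/eqP/(neumann_inj c01 yc).
  rewrite opfD opfN; apply/eqP; rewrite -subr_eq0.
  by rewrite opprD addrACA -opprD E subrr.
by split; apply: op_eq => a; rewrite !opE /=; [exact: Hf|apply: inj; rewrite Hf].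
Qed.

Lemma inv_scB c r u : 0 <= c < r -> bnd c u -> inv (sc r - u).
Proof.
move=> /andP[c0 cr] b.
have r0 : 0 < r by apply: le_lt_trans cr.
have -> : sc r - u = r%:C *: (1 - r^-1%:C *: u).
  by rewrite scE scalerBr scalerA -rmorphM divff ?gt_eqF // scale1r.
apply: inv_scale; first by rewrite gt_eqF.
apply: (@inv_1sub (r^-1 * c)); last by apply: bndZr; rewrite ?invr_ge0 ?ltW.
by rewrite mulr_ge0 ?invr_ge0 ?(ltW r0) //= mulrC ltr_pdivrMr // mul1r.
Qed.
Lemma inv_scD c r u : 0 <= c < r -> bnd c u -> inv (sc r + u).
Proof. by move=> cr /bndN b; rewrite -[u]opprK; apply: inv_scB b. Qed.

Lemma expand_sq u : (1 + u) * (1 - u) = 1 - u * u.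
Proof. by rewrite mulrBr mulr1 mulrDl mul1r addrKA. Qed.

Lemma ii_scale u : 'i *: ('i *: u) = - u.
Proof. by rewrite scalerA -expr2 sqr_i scaleN1r. Qed.

Lemma conjc_i : conjc ('i : R[i]) = - 'i.
Proof. by apply/eqP; rewrite eq_complex /= oppr0 !eqxx. Qed.

(* The real spectrum of a selfadjoint element: shifting by an imaginary scalar brings 1 + ih within reach of the Neumann series. *)
Lemma inv_1addi h : adj h = h -> inv (1 + 'i *: h).
Proof.
move=> hs; have [c c0 b] := bnd_exists h.
(* This [t] gives |y|^2 <= c^2 + t^2 = t + t^2 < (1 + t)^2, while 1 + i h = (1 + t) + i y. *)
pose t := c ^+ 2; pose y := h + 'i *: sc t.
have t0 : 0 < t by rewrite exprn_gt0.
have ay : adj y = h - 'i *: sc t by rewrite adjD hs adjZ adj_sc conjc_i scaleNr.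
have yy : adj y * y = h * h + sc (t ^+ 2).
  rewrite ay mulrDr !mulrBl -!opScaleAl -!opScaleAr !scM_l !scM_r ii_scale.
  rewrite opprK !scE !scalerA -rmorphM expr2 addrA subrK.
  by [].
have d0 : 0 <= c ^+ 2 + t ^+ 2 by rewrite addr_ge0 ?sqr_ge0.
have by_ : bnd (Num.sqrt (c ^+ 2 + t ^+ 2)) y.
  apply: bnd_sqrt; first exact: sqrtr_ge0.
  rewrite sqr_sqrtr // yy; apply: bndD; first by rewrite expr2; apply: bndM => //; apply: ltW.
  by apply: bnd_sc; rewrite sqr_ge0.
have -> : 1 + 'i *: h = sc (1 + t) + 'i *: y.
  rewrite scalerDr ii_scale scD sc1 -addrA; congr (_ + _).
  by rewrite addrCA subrr addr0.
apply: (@inv_scD (normc 'i * Num.sqrt (c ^+ 2 + t ^+ 2))); last exact: bndZ.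
rewrite normc_i mul1r sqrtr_ge0 /= -(@ltr_pXn2r _ 2) ?nnegrE ?sqrtr_ge0 ?addr_ge0 ?ltW //.
by rewrite sqr_sqrtr // -/t; nra.
Qed.

Lemma inv_1addsq h : adj h = h -> inv (1 + h * h).
Proof.
move=> hs; have -> : 1 + h * h = (1 + 'i *: h) * (1 - 'i *: h).
  by rewrite expand_sq -opScaleAl -opScaleAr ii_scale opprK.
apply: invM; first exact: inv_1addi.
by rewrite -scalerN; apply: inv_1addi; rewrite adjN hs.
Qed.

Lemma inv_sc_addsq a b h : adj h = h -> 0 < a -> 0 <= b ->
  inv (sc a + b%:C *: (h * h)).
Proof.
move=> hs a0 b0; pose s := Num.sqrt (b / a).
have ss : s * s = b / a by rewrite -expr2 sqr_sqrtr // divr_ge0 // ltW.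
have -> : sc a + b%:C *: (h * h) = a%:C *: (1 + (s%:C *: h) * (s%:C *: h)).
  rewrite scE -opScaleAl -opScaleAr scalerA -rmorphM ss scalerDr scalerA -rmorphM.
  by rewrite mulrCA divff ?mulr1 // gt_eqF.
apply: inv_scale; first by rewrite gt_eqF.
by apply: inv_1addsq; rewrite adjZr hs.
Qed.

(* [2Gg] is the imaginary part of [Y = G(1 + ig)^2], whose modulus is [G(1 + g^2)]. *)
Lemma bnd_half G g C : 0 <= C -> adj G = G -> adj g = g -> G * g = g * G ->
  bnd C (G * (1 + g * g)) -> bnd (C / 2) (G * g).
Proof.
move=> C0 Gs gs cm b; pose a := 'i *: g; pose W := 1 + a; pose W' := 1 - a.
have aW : adj W = W' by rewrite adjD adj1 adjZ gs conjc_i scaleNr.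
have aW' : adj W' = W by rewrite -aW adjK.
have Ga : G * a = a * G by rewrite -opScaleAr cm opScaleAl.
have GW : W * G = G * W by rewrite mulrDr mulrDl mul1r mulr1 Ga.
have GW' : W' * G = G * W' by rewrite mulrBr mulrBl mul1r mulr1 Ga.
have WW' : W * W' = 1 + g * g.
  by rewrite expand_sq -opScaleAl -opScaleAr ii_scale opprK.
have W'W : W' * W = W * W'.
  by have := expand_sq (- a); rewrite opprK mulrNN => ->; rewrite expand_sq.
pose Y := G * (W * W).
have aY : adj Y = G * (W' * W').
  by rewrite !adjM aW Gs -mulrA GW' mulrA GW' mulrA.
(* As [G], [W] and [W'] commute, replacing W W' by W W does not change the modulus, so [Y] inherits
   the bound [C]. *)
have Z2 : adj (G * (W * W')) * (G * (W * W')) = adj Y * Y.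
  have -> : adj (G * (W * W')) = G * (W * W').
    by rewrite !adjM aW aW' Gs -mulrA GW' mulrA GW mulrA.
  have c1 : W * W' * G = G * (W * W') by rewrite -mulrA GW' mulrA GW mulrA.
  have c2 : W' * W' * G = G * (W' * W') by rewrite -mulrA GW' mulrA GW' mulrA.
  rewrite aY /Y mulrA -[G * (W * W') * G]mulrA c1.
  rewrite [RHS]mulrA -[G * (W' * W') * G]mulrA c2 -!mulrA; congr (_ * (_ * _)).
  by rewrite mulrA -W'W -mulrA [W * (W' * W)]mulrA -W'W -mulrA.
have bY : bnd C Y.
  apply: bnd_sqrt => //; rewrite -Z2 WW' expr2; apply: bndM => //.
  exact: bnd_adj.
have E : Y - adj Y = (2 * 2)%:C *: ('i *: (G * g)).
  rewrite aY -mulrBr opScaleAr -/a.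
  have -> : W * W - W' * W' = W * (W - W') + (W - W') * W'.
    by move: (W) (W') => x z; rewrite mulrBr mulrBl addrA subrK.
  have -> : W - W' = a + a by rewrite opprB addrC addrA subrK.
  have -> : W * (a + a) + (a + a) * W' = a + a + (a + a).
    have E : a * (a + a) = (a + a) * a by rewrite mulrDr mulrDl.
    by rewrite mulrDl mul1r mulrBr mulr1 E addrACA subrr addr0.
  rewrite opScaleAr.
  have -> : (2 * 2)%:C = 1 + 1 + (1 + 1) :> R[i].
    by rewrite rmorphM rmorph_nat; ring.
  by rewrite !scalerDl !scale1r.
move=> x; have := bndB bY (bnd_adj C0 bY) x.
rewrite E !opE !nrmZc normc_i mul1r normc_real ger0_norm; last by lra.
lra.
Qed.

(** * Selfadjoint contractions and the spectral radius *)

Section SpectralRadius.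
Variables (h : op).
Hypothesis hs : adj h = h.

(** The geometric sum of the h^(2j) for j < 2^n, in factored form so that [bnd_half] applies to each
    factor 1 + g^2. *)
Fixpoint dyadic (n : nat) : op :=
  if n is m.+1 then dyadic m * (1 + h ^+ (2 ^ m) * h ^+ (2 ^ m)) else 1.

Let hXs n : adj (h ^+ n) = h ^+ n. Proof. by rewrite adjX hs. Qed.

Lemma dyadic_comm u n : u * h = h * u -> u * dyadic n = dyadic n * u.
Proof.
move=> c; have cX m : u * h ^+ m = h ^+ m * u by apply: commrX.
elim: n => [|n IH] /=; first by rewrite mulr1 mul1r.
rewrite mulrA IH -!mulrA mulrDr mulrDl mulr1 mul1r; congr (_ * (_ + _)).
by rewrite mulrA cX -mulrA cX mulrA.
Qed.

Lemma dyadic_adj n : adj (dyadic n) = dyadic n.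
Proof.
elim: n => [|n IH] /=; first exact: adj1.
rewrite adjM IH adjD adj1 adjM !hXs; apply: dyadic_comm.
rewrite mulrDr mulrDl mulr1 mul1r -!exprD; congr (_ + _).
by rewrite -exprS -exprSr.
Qed.

Lemma dyadic_prod n : (1 - h * h) * dyadic n = 1 - h ^+ (2 ^ n) * h ^+ (2 ^ n).
Proof.
elim: n => [|n IH] /=; first by rewrite mulr1.
rewrite mulrA IH; have -> : h ^+ (2 ^ n.+1) = h ^+ (2 ^ n) * h ^+ (2 ^ n).
  by rewrite -exprD expnS mul2n addnn.
move: (h ^+ _ * _) => y; rewrite -{2}[y]opprK expand_sq; congr (1 - _).
by rewrite mulrN mulNr opprK.
Qed.

(** Each use of [bnd_half] on the last factor 1 + g^2 trades it for g and halves the bound. The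
    collected exponents 1 + 2 + ... + 2^(n-1) give 2^n - 1. *)
Lemma dyadic_lower n C G : 0 <= C -> adj G = G -> G * h = h * G ->
  bnd C (G * dyadic n) -> bnd (C / 2 ^+ n) (G * h ^+ (2 ^ n).-1).
Proof.
move=> C0; elim: n C C0 G => [|n IH] C C0 G Gs cG b.
  by rewrite expr0 divr1.
have cX m : G * h ^+ m = h ^+ m * G by apply: commrX.
pose x := h ^+ (2 ^ n).
have cD : dyadic n * x = x * dyadic n.
  by rewrite -dyadic_comm // /x -exprS -exprSr.
have b1 : bnd (C / 2) (G * dyadic n * x).
  apply: bnd_half; rewrite ?hXs //.
  - by rewrite adjM dyadic_adj Gs; symmetry; apply: dyadic_comm.
  - by rewrite -mulrA cD mulrA cX mulrA.
have -> : G * h ^+ (2 ^ n.+1).-1 = (G * x) * h ^+ (2 ^ n).-1.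
  rewrite -mulrA -exprD; congr (_ * _ ^+ _).
  have := expn_gt0 2 n; rewrite expnS mul2n -addnn; case: (2 ^ n)%N => // m _.
  by rewrite addSn addnS.
have -> : C / 2 ^+ n.+1 = C / 2 / 2 ^+ n.
  by rewrite exprS invfM mulrA.
apply: IH; first by rewrite divr_ge0.
- by rewrite adjM hXs Gs cX.
- by rewrite -mulrA -exprSr exprS !mulrA cG.
- by rewrite -mulrA -cD mulrA.
Qed.

(** For selfadjoint powers the C*-identity turns a bound on a square into its square root, and
    square roots stay below 1. *)
Lemma bnd_root n c : 0 <= c < 1 -> bnd c (h ^+ (2 ^ n)) -> exists2 d, 0 <= d < 1 & bnd d h.
Proof.
elim: n c => [|n IH] c c01 b; first by exists c.
have /andP[c0 c1] := c01; apply: (IH (Num.sqrt c)).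
  by rewrite sqrtr_ge0 -sqrtr1 ltr_sqrt.
apply: bnd_sqrt; rewrite ?sqrtr_ge0 // sqr_sqrtr // hXs -exprD addnn -mul2n.
by rewrite -expnS.
Qed.

(* If [1 - h^2] were invertible, the products [dyadic n = sum_(j < 2^n) h^(2j)] would stay bounded, while [bnd_half] makes them at least [2^n |h^(2^n)|]. *)
Lemma contraction_strict : bnd 1 h -> inv (1 - h * h) -> exists2 d, 0 <= d < 1 & bnd d h.
Proof.
move=> b1 [k [_ kh]]; have [K K0 bK] := bnd_exists k.
have bD n : bnd (K * 2) (dyadic n).
  have -> : dyadic n = k * (1 - h ^+ (2 ^ n) * h ^+ (2 ^ n)).
    by rewrite -dyadic_prod mulrA kh mul1r.
  apply: bndM; rewrite ?(ltW K0) //; apply: bndB; first exact: bnd1.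
  rewrite -exprD -[X in bnd X _](expr1n _ (2 ^ n + 2 ^ n)).
  exact: bndX.
have half01 : 0 <= (2 : R)^-1 < 1 by apply/andP; split; lra.
have [N HN] := geometric_small (K * 2) half01 (ltr01 : 0 < 1).
apply: (@bnd_root N (K * 2 / 2 ^+ N)).
  rewrite divr_ge0 ?exprn_ge0 ?mulr_ge0 ?(ltW K0) //=.
  by have := HN N (leqnn N); rewrite exprVn mulrC.
have K20 : 0 <= K * 2 by rewrite mulr_ge0 // ltW.
have := @dyadic_lower N (K * 2) 1 K20 (adj1 X); rewrite !mul1r mulr1.
move=> /(_ erefl (bD N)) b.
have -> : h ^+ (2 ^ N) = h ^+ (2 ^ N).-1 * h by rewrite -exprSr prednK ?expn_gt0.
by rewrite -[X in bnd X _]mulr1; apply: bndM => //; rewrite divr_ge0 ?exprn_ge0.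
Qed.

End SpectralRadius.

(** This constructs the operator norm. The infimum of all bounds is again a bound because each x
    imposes a closed condition on the constant. *)
Lemma bnd_inf w : exists2 N, 0 <= N /\ bnd N w & forall c, 0 <= c -> bnd c w -> N <= c.
Proof.
pose E := [set c | 0 <= c /\ bnd c w]%classic.
have [c0 c0p bc0] := bnd_exists w.
have E0 : (E !=set0)%classic by exists c0; split => //; apply: ltW.
have Elb : has_lbound E by exists 0 => c [].
have hi : has_inf E by split.
exists (inf E); last by move=> c c1 bc; apply: (inf_lbound Elb).
split; first by apply: lb_le_inf => // c [].
move=> x; have [x0|x0] := eqVneq (nm x) 0.
  by rewrite x0 mulr0; have := bc0 x; rewrite x0 mulr0.
have xp : 0 < nm x by rewrite lt_neqAle eq_sym x0 nrm_ge0.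
rewrite -ler_pdivrMr //; apply: lb_le_inf => // c [_ bc].
by rewrite ler_pdivrMr.
Qed.

(** If the norm N exceeded r, then h = w / N would be a contraction with 1 - h^2 = (1 + h)(1 - h)
    invertible, hence a strict contraction, against the minimality of N. *)
Lemma spectral_radius w r : adj w = w -> 0 <= r ->
  (forall s, r < s -> inv (sc s - w) /\ inv (sc s + w)) -> bnd r w.
Proof.
move=> ws r0 H; have [N [N0 bN] Nmin] := bnd_inf w.
have [Nr|rN] := leP N r; first exact: bnd_weaken bN.
have Np : 0 < N by apply: le_lt_trans rN.
pose h := N^-1%:C *: w.
have hs : adj h = h by rewrite adjZr ws.
have [i1 i2] := H N rN.
have bh : bnd 1 h.
  rewrite -[X in bnd X _](@mulVf _ N) ?gt_eqF //.
  by apply: bndZr; rewrite ?invr_ge0.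
have [|d /andP[d0 d1] bd] := contraction_strict hs bh.
  have e1 : 1 - h = N^-1%:C *: (sc N - w).
    by rewrite scalerBr scE scalerA -rmorphM mulVf ?gt_eqF // scale1r.
  have e2 : 1 + h = N^-1%:C *: (sc N + w).
    by rewrite scalerDr scE scalerA -rmorphM mulVf ?gt_eqF // scale1r.
  rewrite -expand_sq e1 e2.
  by apply: invM; apply: inv_scale; rewrite ?invr_eq0 ?gt_eqF.
have : N <= N * d.
  apply: Nmin; first by rewrite mulr_ge0.
  have -> : w = N%:C *: h by rewrite scalerA -rmorphM divff ?scale1r ?gt_eqF.
  exact: bndZr.
by rewrite -{1}[N]mulr1 ler_pM2l // leNgt d1.
Qed.

End Spectral.

(** * The positive cone *)

Section Cone.
Variables (R : realType) (A : lmodType R[i]) (X : cstar_alg A).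
Local Notation op := (op X).
Implicit Types (s t u w : op).

(** Equivalently, s is selfadjoint and |m - s| <= m for some m > 0: positivity as a norm condition,
    without functional calculus. *)
Definition cone s := exists m Q,
  [/\ 0 < m, adj Q = Q, bnd 1 Q & s = m%:C *: (1 - Q)].

Lemma cone_adj s : cone s -> adj s = s.
Proof. by move=> [m [Q [_ Qs _ ->]]]; rewrite adjZr adjB adj1 Qs. Qed.

Lemma adj_mul_eq0 u : adj u * u = 0 -> u = 0.
Proof.
move=> E; apply: (@bnd_neg_eq0 _ _ _ 0) => //; apply: bnd_sqrt => //.
by rewrite E => x; rewrite opE nrm0 expr2 !mul0r.
Qed.

(** After scaling s to a contraction h, take Q = 1 - h^2. For r > 1 both r - Q = (r - 1) + h^2 and r
    + Q = (r + 1) - h^2 are invertible, so Q is a contraction. *)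
Lemma cone_sq s : adj s = s -> cone (s * s).
Proof.
move=> ss; have [c c0 bc] := bnd_exists s; pose h := c^-1%:C *: s.
have hs : adj h = h by rewrite adjZr ss.
have bh : bnd 1 h.
  rewrite -[X in bnd X _](@mulVf _ c) ?gt_eqF //; apply: bndZr => //.
  by rewrite invr_ge0 ltW.
exists (c ^+ 2), (1 - h * h); split.
- by rewrite exprn_gt0.
- by rewrite adjB adj1 adjM hs.
- apply: spectral_radius => //; first by rewrite adjB adj1 adjM hs.
  move=> r r1; split.
    have -> : sc X r - (1 - h * h) = sc X (r - 1) + 1%:C *: (h * h).
      by rewrite scale1r scD scN sc1 opprB addrA addrAC.
    by apply: inv_sc_addsq; rewrite ?subr_gt0.
  have -> : sc X r + (1 - h * h) = sc X (r + 1) - h * h.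
    by rewrite scD sc1 addrA.
  apply: (@inv_scB _ _ _ (1 * 1)); first by apply/andP; split; lra.
  exact: bndM.
- rewrite subKr -opScaleAl -opScaleAr !scalerA -!rmorphM.
  by rewrite [X in X%:C *: _](_ : _ = 1) ?scale1r //; field; rewrite gt_eqF.
Qed.

(* Writing s = m(1 - Q) and E = r + m t^2, one has r + t^2 s = E (1 - w Q) with w = 1 - r E^-1 a strict contraction. *)
Lemma inv_sc_add_conj r s t : 0 < r -> cone s -> adj t = t ->
  inv (sc X r + t * s * t).
Proof.
move=> r0 [m [Q [m0 Qs bQ ->]]] ts; apply: inv_swap_sc; first by rewrite gt_eqF.
rewrite mulrA; pose E := sc X r + m%:C *: (t * t).
have [F [EF FE]] : inv E by apply: inv_sc_addsq => //; apply: ltW.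
have Es : adj E = E by rewrite adjD adj_sc adjZr adjM ts.
have Fs : adj F = F.
  have EF' : E * adj F = 1 by rewrite -{1}Es -adjM FE adj1.
  by rewrite -[LHS]mul1r -FE -mulrA EF' mulr1.
pose w := 1 - r%:C *: F.
have Fw : F * (m%:C *: (t * t)) = w.
  by rewrite /w -FE /E mulrDr scM_r addrAC subrr add0r.
have ws : adj w = w by rewrite adjB adj1 adjZr Fs.
have Finv : inv F by exists E.
have winv a b : 0 < a -> 0 <= b -> inv (F * (sc X a + b%:C *: (t * t))).
  by move=> a0 b0; apply: invM => //; apply: inv_sc_addsq.
(* Since z = F (z E), the elements z - w and z + w are F times z r + (z - 1) m t^2 and z r + (z + 1)
   m t^2. Both are invertible already at z = 1, which makes [w] strict. *)
have scF z : sc X z = F * (sc X (z * r) + (z * m)%:C *: (t * t)).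
  rewrite scM rmorphM -scalerA scM_l -scalerDr -opScaleAr -/E FE scE //.
have wz z : 1 <= z -> inv (sc X z - w) /\ inv (sc X z + w).
  move=> z1; rewrite scF -Fw -mulrBr -mulrDr -!addrA -scalerBl -scalerDl.
  have -> : (z * m)%:C - m%:C = ((z - 1) * m)%:C by rewrite -rmorphB mulrBl mul1r.
  have -> : (z * m)%:C + m%:C = ((z + 1) * m)%:C by rewrite -rmorphD mulrDl mul1r.
  split; apply: winv; rewrite ?mulr_gt0 ?mulr_ge0 ?subr_ge0 ?(ltW m0) //; lra.
have bw : bnd 1 w by apply: spectral_radius => // z /ltW /wz.
have [|d /andP[d0 d1] bd] := contraction_strict ws bw.
  have [] := wz 1 (lexx 1); rewrite sc1 => i1 i2.
  by rewrite -expand_sq; apply: invM.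
have -> : sc X r + t * t * (m%:C *: (1 - Q)) = E * (1 - w * Q).
  rewrite mulrBr mulr1 -Fw !mulrA EF mul1r /E -addrA; congr (_ + _).
  by rewrite -opScaleAr opScaleAl mulrBr mulr1.
apply: invM; first by exists F.
apply: (@inv_1sub _ _ _ (d * 1)); last exact: bndM.
by rewrite mulr1 d0.
Qed.

(** Adding r > 0 to t s t or to its negative gives an invertible element, so the spectral radius of
    t s t, and hence its norm, is 0. *)
Lemma cone_conj_opp s s' t : cone s -> cone s' -> adj t = t ->
  t * s * t = - (t * s' * t) -> t * s * t = 0.
Proof.
move=> cs cs' ts E; apply: (@bnd_neg_eq0 _ _ _ 0) => //.
apply: spectral_radius => //; first by rewrite !adjM ts (cone_adj cs) mulrA.
move=> r r0; split; last exact: inv_sc_add_conj.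
by rewrite E opprK; apply: inv_sc_add_conj.
Qed.

(** For s = m (1 - Q) one has s^2 + m^2 (1 - Q^2) = 2 m s. Conjugation by t makes t s^2 t the
    negative of a conjugated cone element, so t s^2 t = 0; this is the square of the modulus of s
    t. *)
Lemma cone_conj_eq0 s t : cone s -> adj t = t -> t * s * t = 0 -> s * t = 0.
Proof.
move=> cs ts E; have ss := cone_adj cs; apply: adj_mul_eq0.
rewrite adjM ts ss -mulrA [s * (s * t)]mulrA mulrA.
have [m [Q [m0 Qs bQ sE]]] := cs.
apply: (@cone_conj_opp _ (m%:C *: (m%:C *: (1 - Q * Q)))) => //.
- exact: cone_sq.
- exists (m * m), (Q * Q); split; rewrite ?mulr_gt0 ?adjM ?Qs //.
    by rewrite -[X in bnd X _](mulr1 1); apply: bndM.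
  by rewrite scalerA -rmorphM.
- apply/eqP; rewrite -addr_eq0 -mulrDl -mulrDr.
  have -> : s * s + m%:C *: (m%:C *: (1 - Q * Q)) = (2 * m)%:C *: s.
    rewrite {1}sE -opScaleAl -scalerDr -expand_sq.
    have -> : m%:C *: ((1 + Q) * (1 - Q)) = (1 + Q) * s by rewrite sE -opScaleAr.
    by rewrite -mulrDl addrACA addNr addr0 mulrDl mul1r -mulr2n -scaler_nat scalerA
      [in RHS]mulrC rmorphM rmorph_nat.
  by rewrite -opScaleAr -opScaleAl E scaler0.
Qed.

Lemma cone_add_eq0 s s' t : cone s -> cone s' -> adj t = t ->
  (s + s') * t = 0 -> s * t = 0.
Proof.
move=> cs cs' ts E; apply: cone_conj_eq0 => //.
apply: (@cone_conj_opp _ s') => //.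
by apply/eqP; rewrite -addr_eq0 -mulrDl -mulrDr -mulrA E mulr0.
Qed.

(** Here t s t = - s t^2, and s t^2 has the same spectrum as t s t away from 0. So r + t s t and r -
    t s t are both invertible for r > 0, and t s t = 0. *)
Lemma cone_anticomm s t : cone s -> adj t = t -> t * s + s * t = 0 -> t * s = 0.
Proof.
move=> cs ts E; have ss := cone_adj cs.
have E1 : t * s * t = - (s * t * t).
  by apply/eqP; rewrite -addr_eq0 -mulrDl E mul0r.
have tst0 : t * s * t = 0.
  apply: (@bnd_neg_eq0 _ _ _ 0) => //.
  apply: spectral_radius => //; first by rewrite !adjM ts ss mulrA.
  move=> r r0; split; last exact: inv_sc_add_conj.
  rewrite E1 opprK; apply: inv_swap_sc; first by rewrite gt_eqF.
  by rewrite mulrA; apply: inv_sc_add_conj.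
apply: adj_mul_eq0; rewrite adjM ss ts !mulrA.
by have /eqP := E1; rewrite tst0 eq_sym oppr_eq0 => /eqP ->; rewrite mul0r.
Qed.

(** With Q = 1 - (2 / M) a and r > 1, r + Q is invertible by a Neumann series, and r - Q is a
    multiple of 1 + a / mu, where the spectral hypothesis applies at the negative number - mu. *)
Lemma positive_cone (a : A) : positive X a -> cone (Lm X a).
Proof.
move=> [sa spec]; pose M := nrm X a + 1.
have M0 : 0 < M by rewrite ltr_wpDl ?nrm_ge0.
have asa : adj (Lm X a) = Lm X a by rewrite Lm_star sa.
have bM : bnd M (Lm X a).
  by apply: bnd_weaken (@bnd_Lm _ _ X a); rewrite lerDl.
pose Q := 1 - (2 / M)%:C *: Lm X a.
have Qs : adj Q = Q by rewrite adjB adj1 adjZr asa.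
exists (M / 2), Q; split => //.
- by rewrite divr_gt0.
- apply: spectral_radius => // r r1; split; last first.
    have -> : sc X r + Q = sc X (r + 1) - (2 / M)%:C *: Lm X a.
      by rewrite scD sc1 addrA.
    apply: (@inv_scB _ _ _ (2 / M * M)).
      by rewrite divfK ?gt_eqF //; apply/andP; split; lra.
    by apply: bndZr => //; rewrite divr_ge0 // ltW.
  pose mu := (r - 1) * M / 2.
  have mu0 : 0 < mu by rewrite divr_gt0 ?mulr_gt0 ?subr_gt0.
  have -> : sc X r - Q = (2 / M)%:C *: (mu%:C *: (1 - Lm X ((- mu%:C)^-1 *: a))).
    rewrite LmZ scalerBr !scalerA invrN mulrN divff; last first.
      by rewrite -(rmorph0 (real_complex R)) (inj_eq (@complexI R)) gt_eqF.
    rewrite scaleN1r opprK scalerDr !scalerA -rmorphM -scE /mu.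
    have -> : 2 / M * ((r - 1) * M / 2) = r - 1 by field; rewrite gt_eqF.
    by rewrite scD scN sc1 opprB addrA addrAC.
  apply: inv_scale; first by rewrite gt_eqF ?divr_gt0.
  apply: inv_scale; first by rewrite gt_eqF.
  have [|b [h1 h2]] := spec (- mu%:C).
    rewrite oppr_ge0 -(rmorph0 (real_complex R)) lecR => h.
    by have := le_lt_trans h mu0; rewrite ltxx.
  have key x y : x + y - mul X x y = 0 -> (1 - Lm X x) * (1 - Lm X y) = 1.
    move=> /(congr1 (Lm X)); rewrite Lm0 LmB LmD LmM => e.
    by rewrite mulrBr mulr1 mulrBl mul1r -[_ - _ - _]addrA -opprD addrA e subr0.
  exists (1 - Lm X b); split; apply: key; first exact: h1.
  by rewrite [b + _]addrC.
- rewrite subKr scalerA -rmorphM [X in X%:C *: _](_ : _ = 1) ?scale1r //.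
  by field; rewrite gt_eqF.
Qed.

End Cone.

(** * Double annihilators are hereditary *)

Section Annihilators.
Variables (R : realType) (A : lmodType R[i]) (X : cstar_alg A).
Local Notation "a ** b" := (mul X a b) (at level 40, left associativity).
Local Notation st := (star X).
Local Notation nm := (nrm X).

Lemma starZr (r : R) a : st (r%:C *: a) = r%:C *: st a.
Proof. by rewrite starZ conjc_real. Qed.

Lemma scaler_real_eq0 (r : R) (a : A) : r != 0 -> r%:C *: a = 0 -> a = 0.
Proof.
move=> r0 /(congr1 (fun x => r^-1%:C *: x)).
by rewrite scaler0 scalerA -rmorphM mulVf // scale1r.
Qed.

Lemma double_eq0 (a : A) : a + a = 0 -> a = 0.
Proof.
move=> h; apply: (@scaler_real_eq0 2); first by rewrite pnatr_eq0.
by rewrite rmorph_nat scaler_nat mulr2n.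
Qed.

(** The last clause keeps both parts inside any star-closed subspace containing a, so annihilation
    can be tested on selfadjoint elements. *)
Lemma real_imag_parts a : exists h k, [/\ st h = h, st k = k,
  a = h + 'i *: k & forall P : A -> Prop, (forall x y, P x -> P y -> P (x + y)) ->
    (forall k x, P x -> P (k *: x)) -> (forall x, P x -> P (st x)) -> P a ->
    P h /\ P k].
Proof.
pose c : R[i] := (2^-1)%:C.
exists (c *: (a + st a)), (c *: ('i *: (st a - a))); split.
- by rewrite starZr starD starK addrC.
- rewrite starZr starZ starB starK conjc_i scaleNr -scalerN opprB //.
- have -> : 'i *: (c *: ('i *: (st a - a))) = c *: (a - st a).
    by rewrite !scalerA mulrAC -expr2 sqr_i mulN1r scaleNr -scalerN opprB.
  rewrite -scalerDr addrACA subrr addr0 -mulr2n -scaler_nat scalerA /c.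
  by rewrite -(rmorph_nat (real_complex R)) -rmorphM mulVf ?scale1r // pnatr_eq0.
- move=> P PD PZ Ps Pa; split; first by apply/PZ/PD => //; apply: Ps.
  apply/PZ/PZ/PD; first exact: Ps.
  by rewrite -scaleN1r; apply: PZ.
Qed.

Lemma positive_anticomm s t : positive X s -> st t = t ->
  t ** s + s ** t = 0 -> t ** s = 0 /\ s ** t = 0.
Proof.
move=> ps ts E; have cs := positive_cone ps.
have ts0 : t ** s = 0.
  apply: (@Lm_inj _ _ X); rewrite Lm0 LmM; apply: cone_anticomm => //.
    by rewrite Lm_star ts.
  by rewrite -!LmM -LmD E Lm0.
by split => //; move: E; rewrite ts0 add0r.
Qed.

(** * Annihilators of star-closed sets *)

Section Ann.
Variables (V S : A -> Prop).
Hypothesis VS : cstar_subalg X V.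
Hypothesis Sst : forall s, S s -> S (st s).

Lemma Ann0 : Ann X V S 0.
Proof.
have [[V0 _] _ _ _ _] := VS.
by split=> // s _; rewrite cmul0l cmul0r addr0.
Qed.
Lemma AnnD a b : Ann X V S a -> Ann X V S b -> Ann X V S (a + b).
Proof.
have [[_ VD] _ _ _ _] := VS.
move=> [Va a0] [Vb b0]; split; first exact: VD.
by move=> s Ss; rewrite mulDl mulDr addrACA a0 // b0 // addr0.
Qed.
Lemma AnnZ k a : Ann X V S a -> Ann X V S (k *: a).
Proof.
have [_ VZ _ _ _] := VS.
move=> [Va a0]; split; first exact: VZ.
by move=> s Ss; rewrite mulZl mulZr -scalerDr a0 // scaler0.
Qed.
Lemma Ann_star a : Ann X V S a -> Ann X V S (st a).
Proof.
have [_ _ _ Vs _] := VS.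
move=> [Va a0]; split; first exact: Vs.
move=> s /Sst Ss; have /(congr1 st) := a0 _ Ss.
by rewrite starD !starM starK star0 addrC.
Qed.
Lemma Ann_closed : norm_closed X (Ann X V S).
Proof.
have [_ _ _ _ Vc] := VS.
move=> u l Hu lim; split; first by apply: (Vc u) => // n; have [] := Hu n.
move=> s Ss; apply: (@nrm_small_eq0 _ _ X) => e e0.
pose d := nm s + nm s + 1; have d0 : 0 < d by rewrite ltr_wpDl // addr_ge0 ?nrm_ge0.
have [|N HN] := lim (e / d); first by rewrite divr_gt0.
have {HN} := HN N (leqnn N); rewrite -nrmN opprB ltr_pdivlMr // => HN.
have -> : l ** s + s ** l = (l - u N) ** s + s ** (l - u N).
  rewrite cmulBl cmulBr addrACA -opprD; have [_ ->] := Hu N => //.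
  by rewrite subr0.
apply: le_lt_trans HN; apply: le_trans (nrm_triangle X _ _) _.
have h1 := nrm_submul X (l - u N) s; have h2 := nrm_submul X s (l - u N).
have := nrm_ge0 X (l - u N); rewrite /d; lra.
Qed.
End Ann.

Definition full : A -> Prop := fun=> True.
Lemma full_subalg : cstar_subalg X full.
Proof. by split=> //; split. Qed.

(** * Double annihilators of sets of positive elements *)

Section Hereditary.
Variable S : A -> Prop.
Hypothesis Spos : forall s, S s -> positive X s.
Let T := Ann X full S.
Let V := Ann X full T.

Let Sst s : S s -> S (st s).
Proof. by move=> Ss; have [-> _] := Spos Ss. Qed.
Let Tst t : T t -> T (st t).
Proof. exact: Ann_star full_subalg Sst t. Qed.
Let Vst b : V b -> V (st b).
Proof. exact: Ann_star full_subalg Tst b. Qed.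

Let TD x y : T x -> T y -> T (x + y).
Proof. exact: (@AnnD full S full_subalg x y). Qed.
Let TZ k x : T x -> T (k *: x).
Proof. exact: (@AnnZ full S full_subalg k x). Qed.
Let VD x y : V x -> V y -> V (x + y).
Proof. exact: (@AnnD full T full_subalg x y). Qed.
Let VZ k x : V x -> V (k *: x).
Proof. exact: (@AnnZ full T full_subalg k x). Qed.

(** Positivity of the elements of [S] upgrades anticommutation to two-sided annihilation, which
    squaring preserves. *)
Let Tsq t : T t -> st t = t -> T (t ** t).
Proof.
move=> [_ tS] ts; split=> // s Ss.
have [ts0 st0] := positive_anticomm (Spos Ss) ts (tS _ Ss).
by rewrite mulA st0 cmul0l -mulA ts0 cmul0r addr0.
Qed.

(* b anticommutes with t and with t^2, yet anticommuting with t makes it commute with t^2. *)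
Let sa_mul0 b t : V b -> st b = b -> T t -> st t = t -> b ** t = 0.
Proof.
move=> [_ bT] bs Tt ts; apply: (@mul_star_eq0 _ _ X).
have tb : t ** b = - (b ** t).
  by apply/eqP; rewrite -addr_eq0 addrC bT.
have btt : b ** (t ** t) = 0.
  apply: double_eq0; rewrite -[RHS](bT _ (Tsq Tt ts)); congr (_ + _).
  by rewrite -[RHS]mulA tb cmulNr [t ** (b ** t)]mulA tb cmulNl opprK -mulA.
by rewrite starM bs ts mulA -[b ** t ** t]mulA btt cmul0l.
Qed.

Lemma annihilator_mul0 b t : V b -> T t -> b ** t = 0 /\ t ** b = 0.
Proof.
suff H c s : V c -> T s -> c ** s = 0.
  move=> Vb Tt; split; first exact: H.
  by rewrite -[LHS](starK X) starM H ?star0 //; [apply: Vst|apply: Tst].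
move=> Vc Ts.
have [h [k [hs ks ce /(_ V)]]] := real_imag_parts c.
move=> /(_ VD VZ Vst Vc) [Vh Vk].
have [x [y [xs ys se /(_ T)]]] := real_imag_parts s.
move=> /(_ TD TZ Tst Ts) [Tx Ty].
by rewrite ce se mulDl !mulDr !mulZl !mulZr !sa_mul0 // !scaler0 !addr0.
Qed.

Lemma annihilatorP b : (forall t, T t -> b ** t = 0 /\ t ** b = 0) -> V b.
Proof. by move=> H; split=> // t /H [-> ->]; rewrite addr0. Qed.

Lemma annihilator_corner p a : V p -> V (p ** a ** p).
Proof.
move=> Vp; apply: annihilatorP => t Tt.
have [pt tp] := annihilator_mul0 Vp Tt.
by rewrite -mulA pt cmul0r !mulA tp !cmul0l.
Qed.

Lemma annihilator_subalg : cstar_subalg X V.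
Proof.
split.
- by split; [exact: (@Ann0 full T full_subalg)|exact: VD].
- exact: VZ.
- move=> a b Va Vb; apply: annihilatorP => t Tt.
  have [at0 ta0] := annihilator_mul0 Va Tt; have [bt0 tb0] := annihilator_mul0 Vb Tt.
  by rewrite -mulA bt0 cmul0r mulA ta0 cmul0l.
- exact: Vst.
- exact: (@Ann_closed full T full_subalg).
Qed.

(** For selfadjoint x in [T], b x = 0 reads (a + (b - a)) x = 0 with both summands in the cone,
    whence a x = 0. *)
Lemma annihilator_hereditary : hereditary X V.
Proof.
split; first exact: annihilator_subalg.
move=> a b Vb pa pba; have [as_ _] := pa.
have H t : T t -> a ** t = 0.
  move=> Tt; have [h [k [hs ks te /(_ T)]]] := real_imag_parts t.
  move=> /(_ TD TZ Tst Tt) [Th Tk].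
  have sa x : st x = x -> T x -> a ** x = 0.
    move=> xs Tx; apply: (@Lm_inj _ _ X); rewrite Lm0 LmM.
    apply: (@cone_add_eq0 _ _ _ _ (Lm X (b - a))); rewrite ?Lm_star ?xs //.
    - exact: positive_cone.
    - exact: positive_cone.
    - rewrite -LmD addrC subrK -LmM; have [-> _] := annihilator_mul0 Vb Tx.
      exact: Lm0.
  by rewrite te mulDr mulZr !sa // scaler0 addr0.
apply: annihilatorP => t Tt; split; first exact: H.
by rewrite -[LHS](starK X) starM as_ H ?star0 //; apply: Tst.
Qed.
End Hereditary.

End Annihilators.

(** * The pentagon *)

Section Pentagon.
Variables (R : realType) (A : lmodType R[i]) (X : cstar_alg A).
Local Notation "a ** b" := (mul X a b) (at level 40, left associativity).
Local Notation st := (star X).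
Local Notation nm := (nrm X).

(** * A pentagon criterion for non-modularity *)

Section Lattice.
Variable V : A -> Prop.
Hypothesis V0 : V 0.

Definition ann_hull (S : A -> Prop) := Ann X V (Ann X V S).

Lemma ann_hull_sub (S : A -> Prop) : (forall s, S s -> V s) -> subset S (ann_hull S).
Proof.
by move=> SV s Ss; split; [exact: SV | move=> a [_ aS]; rewrite addrC aS].
Qed.

Lemma ann_hull_mono (S S' : A -> Prop) :
  subset (Ann X V S') (Ann X V S) -> subset (ann_hull S) (ann_hull S').
Proof. by move=> H c [Vc cS]; split=> // a /H /cS. Qed.

(** The hulls x, y, z satisfy x <= z, y meets z in 0, and z lies below the join of x and y. The
    modular law would then equate x with z, which f prevents. *)
Lemma nonmodular_criterion (Sx Sy Sz : A -> Prop) :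
  (forall s, Sx s -> V s /\ positive X s) ->
  (forall s, Sy s -> V s /\ positive X s) ->
  (forall s, Sz s -> V s /\ positive X s) ->
  subset Sx (ann_hull Sz) ->
  (exists2 f, Sz f & ~ ann_hull Sx f) ->
  (forall c, ann_hull Sy c -> ann_hull Sz c -> c = 0) ->
  (forall b, Ann X V Sx b -> Ann X V Sy b -> Ann X V Sz b) ->
  ~ modular_lattice (annihilators X V).
Proof.
move=> px py pz xz [f Szf fx] yz0 xyz [bounds modular].
have inP S : (forall s, S s -> V s /\ positive X s) -> annihilators X V (ann_hull S).
  by move=> pS; exists S; split.
have [[Px Py] Pz] := (inP _ px, inP _ py, inP _ pz).
have sub_xz : subset (ann_hull Sx) (ann_hull Sz).
  apply: ann_hull_mono => a [Va aS]; split=> // s /xz [_ sz].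
  by rewrite addrC sz.
have [_ [m gm]] := bounds _ _ Py Pz.
have [Pm my mz _] := gm.
have [[j1 lj1] _] := bounds _ _ Px Pm.
have [[j2 lj2] _] := bounds _ _ Px Py.
have [Pj2 xj2 yj2 _] := lj2.
have [_ [m2 gm2]] := bounds _ _ Pj2 Pz.
have E := modular _ _ _ _ _ _ _ Px Py Pz sub_xz gm lj1 lj2 gm2.
(* [j2] is the double annihilator of some S. Whatever annihilates S anticommutes with [j2], hence
   annihilates [Sx] and [Sy], and therefore [Sz]. *)
have zj2 : subset (ann_hull Sz) j2.
  have [S [_ j2E]] := Pj2; rewrite j2E; apply: ann_hull_mono => a Sa.
  have kill U : subset U j2 -> (forall s, U s -> a ** s + s ** a = 0).
    by move=> Uj2 s /Uj2; rewrite j2E => -[_ /(_ _ Sa)]; rewrite addrC.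
  have [Va _] := Sa.
  apply: xyz; split=> // s Ss.
    by apply: (kill _ xj2); apply: ann_hull_sub Ss => r /px [].
  by apply: (kill _ yj2); apply: ann_hull_sub Ss => r /py [].
have fz : ann_hull Sz f by apply: ann_hull_sub => // s /pz [].
have [_ _ _ glb2] := gm2; have m2f := glb2 _ Pz zj2 (fun _ h => h) _ fz.
have [_ _ _ lub1] := lj1; apply: fx; apply: (lub1 _ Px) => //.
  move=> c mc; rewrite (yz0 c (my _ mc) (mz _ mc)); split=> // a _.
  by rewrite cmul0l cmul0r addr0.
by rewrite E.
Qed.
End Lattice.

Lemma projection_positive p : projection X p -> positive X p.
Proof.
move=> [pp ps]; split=> // l l0.
have l1 : l != 0 by apply: contra_notN l0 => /eqP ->.
have l2 : l - 1 != 0.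
  by apply: contra_notN l0; rewrite subr_eq0 => /eqP ->; rewrite ler01.
(* Since p is idempotent, the inverse of 1 - p / l is 1 - p / (1 - l). *)
exists ((1 - l)^-1 *: p).
have l3 : 1 - l != 0 by rewrite -opprB oppr_eq0.
rewrite !mulZl !mulZr pp !scalerA -!scalerDl -!scalerBl.
have -> : l^-1 + (1 - l)^-1 - l^-1 * (1 - l)^-1 = 0 by field; apply/andP.
have -> : l^-1 + (1 - l)^-1 - (1 - l)^-1 * l^-1 = 0 by field; apply/andP.
by rewrite scale0r.
Qed.

(** Multiplying by q on either side shows that q b q equals both - q b and - b q. So q b and b q are
    equal as well as opposite. *)
Lemma projection_anticomm q b : projection X q -> b ** q + q ** b = 0 ->
  b ** q = 0 /\ q ** b = 0.
Proof.
move=> [qq qs] E; have bq : b ** q = - (q ** b).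
  by apply/eqP; rewrite -addr_eq0 E.
have e1 : q ** b ** q = - (q ** b) by rewrite -mulA bq cmulNr mulA qq.
have e2 : q ** b ** q = - (b ** q).
  have -> : q ** b = - (b ** q) by rewrite bq opprK.
  by rewrite cmulNl -mulA qq.
have bq0 : b ** q = 0.
  apply: double_eq0; rewrite {2}bq -e1 e2 subrr //.
by split => //; apply/eqP; rewrite -oppr_eq0 -bq bq0.
Qed.

(** * The three annihilators below an infinite projection *)

Section Construction.
Variables (V : A -> Prop) (p q v : A).
Hypothesis VS : cstar_subalg X V.
Hypothesis Vcorner : forall a, V (p ** a ** p).
Hypothesis pP : projection X p.
Hypothesis qP : projection X q.
Hypothesis pq : p ** q = q.
Hypothesis qp : q <> p.
Hypothesis vv : st v ** v = p.
Hypothesis vv' : v ** st v = q.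

Let pp : p ** p = p. Proof. by case: pP. Qed.
Let ps : st p = p. Proof. by case: pP. Qed.
(** The wandering projection of the shift v, orthogonal to the range projection q of v. *)
Let e := p - q.

Let vp : v ** p = v.
Proof.
apply/eqP; rewrite eq_sym -subr_eq0; apply/eqP/(@star_mul_eq0 _ _ X).
have z : st v ** (v - v ** p) = 0 by rewrite cmulBr mulA vv pp subrr.
by rewrite starB starM ps cmulBl z -mulA z cmul0r subr0.
Qed.
Let pv : p ** v = v.
Proof.
have qv : q ** v = v by rewrite -vv' -mulA vv vp.
by rewrite -{1}qv mulA pq qv.
Qed.
Let qp' : q ** p = q.
Proof. by have [_ qs] := qP; rewrite -{1}qs -{1}ps -starM pq. Qed.
Let ee : e ** e = e.
Proof. by case: qP => qq _; rewrite cmulBl !cmulBr pp pq qp' qq subrr subr0. Qed.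
Let es : st e = e.
Proof. by case: qP => _ qs; rewrite starB ps qs. Qed.
Let pe : p ** e = e. Proof. by rewrite cmulBr pp pq. Qed.
Let ev : e ** v = 0.
Proof. by rewrite cmulBl pv -vv' -mulA vv vp subrr. Qed.
Let vse : st v ** e = 0.
Proof. by rewrite -[LHS](starK X) starM starK es ev star0. Qed.
Let e_neq0 : e <> 0.
Proof. by move/eqP; rewrite subr_eq0 eq_sym => /eqP. Qed.

Fixpoint orbit_vec (n : nat) : A := if n is m.+1 then v ** orbit_vec m else e.

Let we n : orbit_vec n ** e = orbit_vec n.
Proof. by elim: n => [|n IH] //=; rewrite -mulA IH. Qed.
Let pw n : p ** orbit_vec n = orbit_vec n.
Proof. by case: n => [|n] //=; rewrite mulA pv. Qed.
(** Common powers of v cancel through v^* v = p; a leftover power meets e and vanishes because e v =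
    0. *)
Let gram i j : st (orbit_vec i) ** orbit_vec j = if i == j then e else 0.
Proof.
elim: i j => [|i IH] [|j] /=; rewrite ?es //.
- by rewrite mulA ev cmul0l.
- by rewrite starM -mulA vse cmul0r.
- by rewrite starM -mulA [st v ** _]mulA vv pw IH.
Qed.

(* A vector is an element k of p A e; after rescaling, k k^* is the projection onto its line. *)
Definition vector (N : R) k := [/\ 0 < N, p ** k = k, k ** e = k & st k ** k = N%:C *: e].
Definition line (N : R) k := N^-1%:C *: (k ** st k).
Definition lines (N : nat -> R) (k : nat -> A) s := exists n, s = line (N n) (k n).

Lemma line_projection N k : vector N k -> projection X (line N k).
Proof.
move=> [N0 pk ke kk]; split; last by rewrite starZr starM starK.
rewrite /line mulZl mulZr -[k ** _ ** _]mulA [st k ** (k ** _)]mulA kk.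
rewrite mulZl mulZr mulA ke !scalerA -!rmorphM.
by rewrite -mulrA mulVf ?mulr1 // gt_eqF.
Qed.

Lemma line_V N k : vector N k -> V (line N k).
Proof.
move=> [_ pk _ _]; have -> : line N k = p ** line N k ** p; last exact: Vcorner.
rewrite mulZr mulZl mulA pk -mulA; congr (_ *: (_ ** _)).
by rewrite -{1}ps -starM pk.
Qed.

(** Membership in an annihilator becomes linear equations on vectors; k is recovered from its line
    through k (k^* k) = N k. *)
Lemma line_vectorP N k b : vector N k ->
  b ** line N k + line N k ** b = 0 <-> b ** k = 0 /\ st k ** b = 0.
Proof.
move=> vk; have [N0 pk ke kk] := vk; have Nn : N != 0 by rewrite gt_eqF.
have Ni : N^-1 != 0 by rewrite invr_eq0.
split; last first.
  by move=> [bk kb]; rewrite /line mulZl mulZr mulA bk -mulA kb cmul0l cmul0r !scaler0 addr0.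
move=> /(projection_anticomm (line_projection vk)) []; rewrite mulZl mulZr.
move=> /(scaler_real_eq0 Ni) h1 /(scaler_real_eq0 Ni) h2; split.
  apply: (scaler_real_eq0 Nn); rewrite -ke -mulZr -mulZr -kk.
  by rewrite !mulA -[b ** k ** st k]mulA h1 cmul0l.
apply: (scaler_real_eq0 Nn); rewrite -[k in st k]ke starM es -mulA -mulZl -kk.
by rewrite -mulA [k ** _]mulA h2 cmul0r.
Qed.

Lemma lines_AnnP N k b : (forall n, vector (N n) (k n)) ->
  Ann X V (lines N k) b <-> V b /\ forall n, b ** k n = 0 /\ st (k n) ** b = 0.
Proof.
move=> vk; split=> [[Vb H]|[Vb H]]; split=> //.
  by move=> n; apply/(line_vectorP _ (vk n))/H; exists n.
by move=> _ [n ->]; apply/(line_vectorP _ (vk n)).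
Qed.

Lemma lines_pos N k : (forall n, vector (N n) (k n)) ->
  forall s, lines N k s -> V s /\ positive X s.
Proof.
move=> vk _ [n ->]; split; first exact: line_V.
exact/projection_positive/line_projection.
Qed.

Lemma lines_star N k s : lines N k s -> lines N k (st s).
Proof. by move=> [n ->]; exists n; rewrite starZr starM starK. Qed.

(** The ratio 1/4 outweighs the factor 2 in [graph_diff], leaving the contraction factor 1/2 used in
    [join_kills]. *)
Definition slope (n : nat) : R := (4^-1) ^+ n.
Definition graph_vec n := orbit_vec n.*2 + (slope n)%:C *: orbit_vec n.*2.+1.
(** The orthogonal partner of [graph_vec n] in the plane of the same two orbit vectors; its line
    lies in the annihilator of z. *)
Definition graph_orth n := orbit_vec n.*2.+1 - (slope n)%:C *: orbit_vec n.*2.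
Definition graph_diff n := graph_vec n - 2%:C *: graph_vec n.+1.
Definition graph_norm n : R := 1 + slope n ^+ 2.
Definition diff_norm n : R := graph_norm n + 4 * graph_norm n.+1.

Let graph_norm_gt0 n : 0 < graph_norm n.
Proof. by rewrite ltr_pwDl // sqr_ge0. Qed.
Let slope_neq0 n : slope n != 0.
Proof. by rewrite expf_neq0 // invr_eq0 pnatr_eq0. Qed.

Let eq_double n m : (n.*2 == m.*2) = (n == m).
Proof. by rewrite -!muln2 eqn_pmul2r. Qed.
Let eq_double_odd n m : (n.*2 == m.*2.+1) = false.
Proof. by apply/negP => /eqP /(congr1 odd); rewrite /= !odd_double. Qed.

Let gram_ee n m : st (orbit_vec n.*2) ** orbit_vec m.*2 = if n == m then e else 0.
Proof. by rewrite gram eq_double. Qed.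
Let gram_oo n m : st (orbit_vec n.*2.+1) ** orbit_vec m.*2.+1 = if n == m then e else 0.
Proof. by rewrite gram eqSS eq_double. Qed.
Let gram_eo n m : st (orbit_vec n.*2) ** orbit_vec m.*2.+1 = 0.
Proof. by rewrite gram eq_double_odd. Qed.
Let gram_oe n m : st (orbit_vec n.*2.+1) ** orbit_vec m.*2 = 0.
Proof. by rewrite gram eq_sym eq_double_odd. Qed.

Let gram_u n m : st (graph_vec n) ** graph_vec m = if n == m then (graph_norm n)%:C *: e else 0.
Proof.
rewrite starD starZr mulDl !mulDr !mulZl !mulZr gram_ee gram_oo gram_eo gram_oe.
rewrite !scaler0 addr0 add0r; case: eqP => [->|_]; last by rewrite !scaler0 addr0.
by rewrite scalerA -rmorphM -expr2 /graph_norm rmorphD scalerDl scale1r.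
Qed.
Let gram_uu' n m : st (graph_vec n) ** graph_orth m = 0.
Proof.
rewrite starD starZr mulDl !cmulBr !mulZl !mulZr gram_ee gram_oo gram_eo gram_oe.
rewrite !scaler0 subr0 sub0r; case: eqP => [->|_]; last by rewrite !scaler0 addr0 oppr0.
by rewrite addNr.
Qed.

Let vector_w n : vector 1 (orbit_vec n).
Proof. by split; rewrite ?ltr01 ?pw ?we // gram eqxx scale1r. Qed.
Let vector_u n : vector (graph_norm n) (graph_vec n).
Proof.
split=> //; first by rewrite mulDr mulZr !pw.
  by rewrite mulDl mulZl !we.
by rewrite gram_u eqxx.
Qed.
Let vector_u' n : vector (graph_norm n) (graph_orth n).
Proof.
split=> //; first by rewrite cmulBr mulZr !pw.
  by rewrite cmulBl mulZl !we.
rewrite starB starZr cmulBl !cmulBr !mulZl !mulZr gram_ee gram_oo gram_eo gram_oe.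
rewrite !eqxx !scaler0 subr0 sub0r opprK scalerA -rmorphM -expr2.
by rewrite /graph_norm rmorphD scalerDl scale1r.
Qed.
Let vector_kap n : vector (diff_norm n) (graph_diff n).
Proof.
have [_ pu ue _] := vector_u n; have [_ pu1 ue1 _] := vector_u n.+1.
split; first by rewrite addr_gt0 // mulr_gt0.
- by rewrite cmulBr mulZr pu pu1.
- by rewrite cmulBl mulZl ue ue1.
rewrite starB starZr cmulBl !cmulBr !mulZl !mulZr !gram_u !eqxx.
rewrite -[n.+1 == n]eq_sym !(ltn_eqF (ltnSn n)) !scaler0 subr0 sub0r opprK.
by rewrite !scalerA -!rmorphM -scalerDl -rmorphD; congr (_%:C *: _).
Qed.

Definition even_lines := lines (fun=> 1) (fun n => orbit_vec n.*2).
Definition graph_lines := lines graph_norm graph_vec.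
Definition diff_lines := lines diff_norm graph_diff.

Let AnnyP b := @lines_AnnP (fun=> 1) (fun n => orbit_vec n.*2) b (fun n => vector_w n.*2).
Let AnnzP b := @lines_AnnP graph_norm graph_vec b vector_u.
Let AnnxP b := @lines_AnnP diff_norm graph_diff b vector_kap.

(** The odd orbit lines annihilate y and the [graph_orth] lines annihilate z, so c kills both
    families. As the slopes are nonzero, c also kills the even orbit vectors. *)
Lemma meet_trivial c : ann_hull V even_lines c -> ann_hull V graph_lines c -> c = 0.
Proof.
move=> [Vc cy] [_ cz].
have kill_o n : c ** orbit_vec n.*2.+1 = 0 /\ st (orbit_vec n.*2.+1) ** c = 0.
  apply/(line_vectorP _ (vector_w _))/cy/AnnyP; split.
    exact: (line_V (vector_w _)).
  move=> m; split; first by rewrite /line mulZl -mulA gram_oe cmul0r scaler0.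
  by rewrite /line mulZr mulA gram_eo cmul0l scaler0.
have kill_u' n : c ** graph_orth n = 0 /\ st (graph_orth n) ** c = 0.
  apply/(line_vectorP _ (vector_u' _))/cz/AnnzP; split.
    exact: (line_V (vector_u' _)).
  have u'u m k : st (graph_orth m) ** graph_vec k = 0.
    by rewrite -[LHS](starK X) starM starK gram_uu' star0.
  move=> m; split; first by rewrite /line mulZl -mulA u'u cmul0r scaler0.
  by rewrite /line mulZr mulA gram_uu' cmul0l scaler0.
have cAnn : Ann X V even_lines c.
  apply/AnnyP; split=> // n; have [c1 c2] := kill_o n; have [] := kill_u' n.
  rewrite cmulBr mulZr c1 sub0r starB starZr cmulBl mulZl c2 sub0r.
  move=> /eqP; rewrite oppr_eq0 => /eqP /(scaler_real_eq0 (slope_neq0 n)) ->.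
  by move=> /eqP; rewrite oppr_eq0 => /eqP /(scaler_real_eq0 (slope_neq0 n)) ->.
have csAnn : Ann X V even_lines (st c) by apply: Ann_star => //; apply: lines_star.
(* Now c lies in the annihilator of y and in its double annihilator, so it anticommutes with itself
   and with its adjoint. This forces c = 0. *)
have cc : c ** c = 0 by apply: double_eq0; exact: cy.
have ccs := cy _ csAnn.
have cs : st c = - c.
  apply/eqP; rewrite -addr_eq0; apply/eqP/(@star_mul_eq0 _ _ X).
  rewrite starD starK mulDl !mulDr cc -starM cc star0 addr0 add0r.
  exact: ccs.
by apply: (@star_mul_eq0 _ _ X); rewrite cs cmulNl cc oppr0.
Qed.

(* The coefficients of b along w_(2n+1) double at each step although b is bounded. *)
Lemma join_kills b : Ann X V diff_lines b -> Ann X V even_lines b -> forall n, b ** graph_vec n = 0.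
Proof.
move=> /AnnxP [_ bx] /AnnyP [_ by_].
(* In b u_n = 2 b u_(n+1) the even terms vanish; the factor is 2 times the ratio 1/4 of consecutive
   slopes. *)
have step n : b ** orbit_vec n.*2.+1 = 2^-1%:C *: (b ** orbit_vec n.+1.*2.+1).
  have [+ _] := bx n; rewrite cmulBr mulZr !mulDr !mulZr.
  have [-> _] := by_ n; have [-> _] := by_ n.+1; rewrite !add0r => /eqP.
  rewrite subr_eq0 scalerA -rmorphM => /eqP /(congr1 (fun x => (slope n)^-1%:C *: x)).
  rewrite !scalerA -!rmorphM mulVf // scale1r => ->; congr (_%:C *: _).
  by rewrite /slope exprS; field; rewrite expf_neq0 // invr_eq0 pnatr_eq0.
have iter m n : b ** orbit_vec n.*2.+1 = ((2^-1) ^+ m)%:C *: (b ** orbit_vec (n + m).*2.+1).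
  elim: m n => [|m IH] n; first by rewrite addn0 expr0 scale1r.
  by rewrite step IH scalerA -rmorphM -exprS addSnnS.
(* A crude uniform bound is enough: |w|^2 = |e| and t <= t^2 + 1. *)
have nw n : nm (orbit_vec n) <= nm e + 1.
  have := nrm_cstar X (orbit_vec n); rewrite gram eqxx => ->.
  by have := nrm_ge0 X (orbit_vec n); nra.
have kill n : b ** orbit_vec n.*2.+1 = 0.
  apply: (@nrm_small_eq0 _ _ X) => d d0.
  have half01 : 0 <= (2 : R)^-1 < 1 by apply/andP; split; lra.
  have [M HM] := geometric_small (nm b * (nm e + 1)) half01 d0.
  apply: le_lt_trans (HM M (leqnn M)); rewrite (iter M n) nrmZc normc_real.
  rewrite ger0_norm ?exprn_ge0 ?invr_ge0 //; apply: ler_wpM2l.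
    by rewrite exprn_ge0 ?invr_ge0.
  apply: le_trans (nrm_submul X _ _) _; apply: ler_wpM2l; first exact: nrm_ge0.
  exact: nw.
by move=> n; rewrite mulDr mulZr kill; have [-> _] := by_ n; rewrite scaler0 addr0.
Qed.

(* [beta = sum_n 2^-n w_(2n)] is orthogonal to every [u_n - 2 u_(n+1)] but not to [u_0]. *)
Lemma geometric_vector : exists beta, beta = e + 2^-1%:C *: (v ** v ** beta).
Proof.
have np : nm p <= 1.
  have := nrm_cstar X p; rewrite ps pp; have := nrm_ge0 X p; nra.
have nv : nm (v ** v) <= 1.
  apply: le_trans (nrm_submul X _ _) _; rewrite -expr2 -nrm_cstar vv //.
have h01 : 0 <= (2 : R)^-1 < 1 by apply/andP; split; lra.
have b : bnd 2^-1 (2^-1%:C *: Lm X (v ** v)).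
  rewrite -[X in bnd X _](mulr1 2^-1); apply: bndZr; first by rewrite invr_ge0.
  exact: bnd_weaken nv (@bnd_Lm _ _ X _).
have [beta Hb] := neumann_surj h01 b e.
by exists beta; rewrite -{1}Hb subrK.
Qed.

(** The witness is the line of u_0. The element B = beta beta^* annihilates every difference line,
    since u_n pairs with beta to 2^-n e, but it does not annihilate u_0. *)
Lemma not_below : exists2 f, graph_lines f & ~ ann_hull V diff_lines f.
Proof.
have [beta bE] := geometric_vector.
have pb : p ** beta = beta by rewrite bE mulDr mulZr pe !mulA pv.
have vvb : st v ** (v ** beta) = beta by rewrite mulA vv pb.
have eb : e ** beta = e.
  by rewrite bE mulDr mulZr ee !mulA ev !cmul0l scaler0 addr0.
have vb : st v ** beta = 2^-1%:C *: (v ** beta).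
  by rewrite {1}bE mulDr mulZr vse add0r -[v ** v ** beta]mulA mulA vv mulA pv.
have w0 n : st (orbit_vec n.*2) ** beta = ((2^-1) ^+ n)%:C *: e.
  elim: n => [|n IH] /=; first by rewrite es eb scale1r.
  rewrite !starM -!mulA vb !mulZr vvb IH scalerA -rmorphM -exprS //.
have w1 n : st (orbit_vec n.*2.+1) ** beta = 0.
  elim: n => [|n IH] /=; first by rewrite starM es -mulA vb mulZr mulA ev cmul0l scaler0.
  by rewrite !starM -!mulA vb !mulZr vvb mulA -starM IH scaler0.
have ub n : st (graph_vec n) ** beta = ((2^-1) ^+ n)%:C *: e.
  by rewrite starD starZr mulDl mulZl w0 w1 scaler0 addr0.
have kb n : st (graph_diff n) ** beta = 0.
  rewrite starB starZr cmulBl mulZl !ub scalerA -rmorphM exprS mulrA mulfV ?pnatr_eq0 //.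
  by rewrite mul1r subrr.
pose B := beta ** st beta.
have BAnn : Ann X V diff_lines B.
  apply/AnnxP; split.
    have -> : B = p ** B ** p; last exact: Vcorner.
    by rewrite /B mulA pb -mulA -{1}ps -starM pb.
  move=> n; split; last by rewrite mulA kb cmul0l.
  by rewrite -mulA -[st beta ** _](starK X) starM starK kb star0 cmul0r.
exists (line (graph_norm 0) (graph_vec 0)); first by exists 0%N.
move=> [_ /(_ _ BAnn)] H; have {}H : B ** line (graph_norm 0) (graph_vec 0) + line (graph_norm 0) (graph_vec 0) ** B = 0.
  by rewrite addrC.
(* Otherwise e beta^* = 0, since u_0 pairs with beta to e. Taking adjoints, beta e = 0, and then e =
   e beta e = 0. *)
have [_] := (line_vectorP _ (vector_u 0)).1 H.
rewrite mulA ub expr0 scale1r => /(congr1 st).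
rewrite starM starK es star0 => be0; apply: e_neq0.
by rewrite -ee -[X in X ** e]eb -mulA be0 cmul0r.
Qed.

Lemma infinite_corner_nonmodular : ~ modular_lattice (annihilators X V).
Proof.
apply: (@nonmodular_criterion V _ diff_lines even_lines graph_lines).
- by case: VS => [[]].
- exact: lines_pos vector_kap.
- exact: (@lines_pos (fun=> 1) (fun n => orbit_vec n.*2) (fun n => vector_w n.*2)).
- exact: lines_pos vector_u.
- move=> _ [n ->]; split; first exact: line_V.
  move=> a /AnnzP [_ az]; rewrite addrC; apply/(line_vectorP _ (vector_kap n)).
  have [a1 a2] := az n; have [a3 a4] := az n.+1.
  by rewrite cmulBr mulZr starB starZr cmulBl mulZl a1 a2 a3 a4 scaler0 subr0.
- exact: not_below.
- exact: meet_trivial.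
- move=> b bx by_; apply/AnnzP; split; first by case: bx.
  move=> n; split; first exact: join_kills.
  (* The left-hand equations follow from the right-hand ones for the adjoint of b, because the
     annihilators are star-closed. *)
  rewrite -[LHS](starK X) starM starK (@join_kills (st b)) ?star0 //.
    by apply: Ann_star => //; apply: lines_star.
  by apply: Ann_star => //; apply: lines_star.
Qed.

End Construction.
End Pentagon.

(** * Pure infiniteness puts a pentagon in every nonzero annihilator *)

Theorem theorem29 (R : realType) (A : GRing.Lmodule.type R[i]) (X : cstar_alg A) :
  simple_cstar X -> purely_infinite X -> type_III X.
Proof.
move=> _ pinf V [S [Spos VE]] Vnz.
have {}Spos s : S s -> positive X s by move=> /Spos [].
have her : hereditary X V by rewrite VE; exact: annihilator_hereditary.
have [p [Vp [pP [q [[qP pq] [qp [v [vv vv']]]]]]]] := pinf V her Vnz.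
apply: (@infinite_corner_nonmodular _ _ _ V p q v) => //; first by case: her.
by move=> a; move: Vp; rewrite VE; apply: annihilator_corner.
Qed.
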